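(* Let $\mathcal{X}=\{x_1,\dots,x_7\}$ and $\mathcal{Y}=\{y_1,\dots,y_7\}$ be two sets of seven generic ordered points in $\mathbb{P}^3$. Their centers-variety consists of three distinct points of $\mathbb{P}^3\times\mathbb{P}^3$.
   Context: All projective spaces are over $\mathbb{C}$. A projective camera is a linear map $A:\mathbb{P}^3\dashrightarrow\mathbb{P}^2$ represented (up to scale) by a $3\times 4$ matrix of rank three. Its center is the unique $a\in\mathbb{P}^3$ with $Aa=0$, and the image $Ax$ of $x\in\mathbb{P}^3$ is defined if and only if $x\ne a$. For cameras $A,B$ whose centers do not lie in $\mathcal{X}$, $\mathcal{Y}$ respectively, write $(Ax_i)_{i=1}^7\sim(By_i)_{i=1}^7$ if there is $H\in \mathrm{SL}(3)$ such that $Ax_i=HBy_i$ in $\mathbb{P}^2$ for all $i$. This condition depends on $A,B$ only through their centers. Let $2\mathcal{X}$ denote the union of all lines joining two distinct points of $\mathcal{X}$. For seven-point sets $\mathcal{X},\mathcal{Y}$, the centers-variety is the Zariski closure in $\mathbb{P}^3\times\mathbb{P}^3$ of the locus of pairs of camera centers $(a,b)\in(\mathbb{P}^3\setminus 2\mathcal{X})\times(\mathbb{P}^3\setminus 2\mathcal{Y})$ such that cameras $A,B$ with centers $a,b$ satisfy $(Ax_i)_{i=1}^7\sim(By_i)_{i=1}^7$. ''Generic'' means: for all $(\mathcal{X},\mathcal{Y})$ in some nonempty Zariski open subset of $(\mathbb{P}^3)^7\times(\mathbb{P}^3)^7$. *)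

(* Defs.v *)
From HB Require Import structures.
From mathcomp Require Import all_boot all_order all_algebra.
From mathcomp Require Import mpoly complex.
From mathcomp Require Import boolp classical_sets reals.

Set Implicit Arguments.
Unset Strict Implicit.
Unset Printing Implicit Defensive.

Local Open Scope classical_set_scope.
Local Open Scope ring_scope.

(* P^n over K: the lines through the origin of the column space K^(n+1). *)
Record projspace (K : fieldType) (n : nat) := ProjPoint {
  proj_line :> {vspace 'cV[K]_n.+1};
  _ : \dim proj_line == 1%N }.

HB.instance Definition _ K n := [isSub for @proj_line K n].

Section Zariski.
Variables (K : closedFieldType) (n k : nat).

(* Polynomials in homogeneous coordinates on (P^n)^k: coordinate [j] of the
   [i]-th factor is the variable of index [mxvec_index j i]. *)
Definition multihomog (d : 'I_k -> nat) (f : {mpoly K[n.+1 * k]}) : Prop :=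
  forall m, m \in msupp f ->
  forall i : 'I_k, (\sum_(j < n.+1) m (mxvec_index j i))%N = d i.

(* [M] lists homogeneous coordinates of the points of [p], one per column;
   a column cannot vanish as the points of [p] have dimension 1. *)
Definition hcoords (p : k.-tuple (projspace K n)) (M : 'M[K]_(n.+1, k)) :
  Prop := forall i : 'I_k, <[col i M]>%VS = tnth p i.

Definition vanishes_at (f : {mpoly K[n.+1 * k]})
    (p : k.-tuple (projspace K n)) : Prop :=
  forall M, hcoords p M -> f.@[fun l => mxvec M 0 l] = 0.

Definition zariski_closed (Z : set (k.-tuple (projspace K n))) : Prop :=
  exists2 F : set {mpoly K[n.+1 * k]},
    forall f, F f -> exists d, multihomog d f &
    Z = [set p | forall f, F f -> vanishes_at f p].

Definition zariski_open (U : set (k.-tuple (projspace K n))) : Prop :=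
  zariski_closed (~` U).

Definition zariski_closure (S : set (k.-tuple (projspace K n))) :
  set (k.-tuple (projspace K n)) := smallest zariski_closed S.

End Zariski.

Section Cameras.
Variable K : closedFieldType.

(* The partial map P^n --> P^m of [A], as a relation: as [z] has dimension 1,
   no [z] is related to a point [x] contained in the kernel of [A]. *)
Definition maps_to m n (A : 'M[K]_(m.+1, n.+1)) (x : projspace K n)
    (z : projspace K m) : Prop :=
  (linfun (mulmx A) @: x)%VS = z.

Definition camera (A : 'M[K]_(3, 4)) : Prop := \rank A = 3%N.

Definition center (A : 'M[K]_(3, 4)) (a : projspace K 3) : Prop :=
  (linfun (mulmx A) @: a)%VS = 0%VS.

Definition same_pictures (X Y : 7.-tuple (projspace K 3))
    (A B : 'M[K]_(3, 4)) : Prop :=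
  exists2 H : 'M[K]_3, \det H = 1 &
  forall i : 'I_7, exists2 z : projspace K 2,
    maps_to A (tnth X i) z & maps_to (H *m B) (tnth Y i) z.

Definition secant_lines (X : 7.-tuple (projspace K 3)) :
    set (projspace K 3) :=
  [set x | exists i j : 'I_7, tnth X i <> tnth X j /\
     (x <= tnth X i + tnth X j)%VS].

(* P^3 x P^3 is rendered as the 2-tuples of points of P^3.
   The relation [same_pictures] depends on the cameras only through their
   centers, so quantifying [A] and [B] existentially or universally is
   immaterial. *)
Definition centers_locus (X Y : 7.-tuple (projspace K 3)) :
    set (2.-tuple (projspace K 3)) :=
  [set c | exists a b : projspace K 3,
     [/\ c = [tuple a; b], ~ secant_lines X a, ~ secant_lines Y b &
      exists A B : 'M[K]_(3, 4),
        [/\ camera A /\ center A a, camera B /\ center B b &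
         same_pictures X Y A B]]].

Definition centers_variety (X Y : 7.-tuple (projspace K 3)) :
    set (2.-tuple (projspace K 3)) :=
  zariski_closure (centers_locus X Y).

End Cameras.

(* Main.v *)
Require Import Defs.
From HB Require Import structures.
From mathcomp Require Import all_boot all_order all_fingroup all_algebra.
From mathcomp Require Import mpoly complex.
From mathcomp Require Import boolp classical_sets reals.
From mathcomp Require Import ring.

Set Implicit Arguments.
Unset Strict Implicit.
Unset Printing Implicit Defensive.

Import GRing.Theory.
Local Open Scope ring_scope.

(** Let the columns of the 4 x 7 matrices X and Y be homogeneous coordinates
    of the points. Cameras A and B (a change of image coordinates being
    absorbed in B) take the same pictures when A X = B Y D with D diagonal and
    invertible. Multiplication by the adjugates of the first four columns
    turns X and Y into [1 | x] and [1 | y], up to scaling of the columns. On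
    the first four points the equation then expresses A through B, and on the
    last three it says that B kills certain vectors; since the kernel of B is a
    line, spanned by some be, this means
        y_jk mu_k = lam_j x_jk + be_j p_k     (j < 4, k < 3)      [solves]
    with lam, mu the diagonal of D up to that scaling, and p arbitrary; the two
    centers have the coordinates be_j / lam_j and be_j. Pairs of centers are
    thus solutions of these equations ([solves_of_cameras], [cameras_of_solves]).

    Eliminating lam and be, row j says that x_j, mu * y_j (entrywise) and p are
    linearly dependent. Their determinant is linear in the six products
    v_k = mu_(k+1) p_(k+2), w_k = mu_(k+2) p_(k+1) (indices mod 3).
    Four linear equations in six unknowns leave a pencil, and six nonzero
    numbers are such products exactly when v_0 v_1 v_2 = w_0 w_1 w_2
    ([prod_of_cubic]). A cubic form on a pencil has three roots
    ([pencil_points]); each gives mu and p, and then lam and be, up to the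
    scalings that fix the centers ([solves_exists], [solves_unique]).

    This works when finitely many polynomials in x and y do not vanish: the
    4 x 4 minors of the system (then no v_k or w_k is zero), the discriminant
    of the cubic, the entries of y, and determinants that keep p from being
    parallel to x_j or to mu * y_j. Further, a center on a line through two of
    the points would make the cross-ratios of four planes through that line and
    through its counterpart agree ([center_off_secants]); once this is excluded,
    distinct roots give distinct pairs of centers ([same_centers]).

    Each of these polynomials is nonzero because it is nonzero at some matrices
    with entries 0, 1 and -1. They need not be multihomogeneous: for any
    polynomial f, the configurations having some homogeneous coordinates at
    which f is nonzero form a Zariski open set ([zariski_open_nonzeros]), as a
    polynomial that vanishes at all rescalings of a point has multihomogeneous
    parts that vanish there. Finally the locus of pairs of centers is a set of
    three points, hence closed, hence equal to the centers variety. *)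

(** * Triples with cyclic indices *)

Lemma ordS3 (k : 'I_3) : ordS (ordS (ordS k)) = k.
Proof. by apply: val_inj; case: k => [[|[|[|//]]] ?]. Qed.

Lemma sum3 (V : nmodType) (F : 'I_3 -> V) (k : 'I_3) :
  \sum_m F m = F k + F (ordS k) + F (ordS (ordS k)).
Proof.
rewrite !big_ord_recl big_ord0 addr0.
have E i j : i = j -> F i = F j by move->.
case: k => [[|[|[|//]]] lt_k3].
- by rewrite addrA; congr (_ + _ + _); apply: E; apply: val_inj.
- by rewrite addrC; congr (_ + _ + _); apply: E; apply: val_inj.
- by rewrite addrA addrC addrA; congr (_ + _ + _); apply: E; apply: val_inj.
Qed.

Lemma forall3 (P : 'I_3 -> Prop) (k : 'I_3) :
  P k -> P (ordS k) -> P (ordS (ordS k)) -> forall m, P m.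
Proof.
move=> P0 P1 P2 m.
have : [|| m == k, m == ordS k | m == ordS (ordS k)].
  by case: k m {P0 P1 P2} => [[|[|[|//]]] ?] [[|[|[|//]]] ?].
by case/or3P => /eqP->.
Qed.

Section Cross.
Variable K : fieldType.
Implicit Types x z p : 'I_3 -> K.

Definition cross x z (k : 'I_3) : K :=
  x (ordS k) * z (ordS (ordS k)) - x (ordS (ordS k)) * z (ordS k).

Lemma cross_comb x z p (s t : K) :
  (forall k, z k = s * x k + t * p k) -> \sum_k x k * cross z p k = 0.
Proof. by move=> zE; rewrite (sum3 _ ord0) /cross !zE !ordS3; ring. Qed.

(** Cramer's rule: the coefficients are the [k]-th coordinates of [cross z p]
    and [cross x z] over that of [cross x p]. The [k]-th coordinate of the
    relation is then the vanishing of the triple product, and the other two are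
    identities. *)
Lemma comb_of_cross x z p (k : 'I_3) :
  cross x p k != 0 -> \sum_k x k * cross z p k = 0 ->
  exists s t, forall m, z m = s * x m + t * p m.
Proof.
move=> d0; rewrite (sum3 _ k) => e.
exists (cross z p k / cross x p k), (cross x z k / cross x p k) => m.
suff: cross x p k * z m = cross z p k * x m + cross x z k * p m.
  by move=> E; apply: (mulfI d0); rewrite E; field.
move: e; rewrite /cross !ordS3 => e.
move: m; apply: (@forall3 _ k); rewrite /cross ?ordS3.
- rewrite -[LHS]addr0 -e; ring.
- ring.
- ring.
Qed.

Lemma cross_indep x p (s t : K) (k : 'I_3) : cross x p k != 0 ->
  (forall m, s * x m + t * p m = 0) -> s = 0.
Proof.
move=> xp0 e; apply: (mulIf xp0); rewrite mul0r /cross.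
transitivity ((s * x (ordS k) + t * p (ordS k)) * p (ordS (ordS k))
  - (s * x (ordS (ordS k)) + t * p (ordS (ordS k))) * p (ordS k)).
  by ring.
by rewrite !e !mul0r subrr.
Qed.

End Cross.

(** * The pencil of linear relations and its cubic *)

Section Pencil.
Variable K : fieldType.
Implicit Types (x y : 'M[K]_(4, 3)) (v w mu p : 'I_3 -> K).

(** The triple product of [x j], the entrywise product of [mu] and [y j], and
    [p], with [v k] and [w k] in place of the products of an entry of [mu] and
    one of [p]; see [vprod], [wprod] and [in_pencil_cross]. *)
Definition in_pencil x y v w : Prop := forall j,
  \sum_k x j k * (y j (ordS k) * v k - y j (ordS (ordS k)) * w k) = 0.

Definition on_cubic v w : Prop := \prod_k v k = \prod_k w k.

Definition vcol x y (k : 'I_3) : 'cV[K]_4 :=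
  \col_j (x j k * y j (ordS k)).
Definition wcol x y (k : 'I_3) : 'cV[K]_4 :=
  - \col_j (x j k * y j (ordS (ordS k))).

(** The matrix of the linear system [in_pencil] without the columns of the
    unknowns [v k] and [w l]. *)
Definition minor_mx x y (k l : 'I_3) : 'M[K]_4 :=
  \matrix_(j, i) [:: vcol x y (ordS k) j 0; vcol x y (ordS (ordS k)) j 0;
                     wcol x y (ordS l) j 0; wcol x y (ordS (ordS l)) j 0]`_i.

Lemma sum4 (V : nmodType) (F : 'I_4 -> V) :
  \sum_i F i = F (inord 0) + F (inord 1) + F (inord 2) + F (inord 3).
Proof.
rewrite !big_ord_recl big_ord0 addr0 !addrA.
by congr (F _ + F _ + F _ + F _); apply: val_inj; rewrite /= inordK.
Qed.

Lemma in_pencil_minor x y v w (k l : 'I_3) : in_pencil x y v w <->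
  minor_mx x y k l *m
    (\col_i [:: v (ordS k); v (ordS (ordS k));
                w (ordS l); w (ordS (ordS l))]`_i) =
  - (v k *: vcol x y k + w l *: wcol x y l).
Proof.
have E j : (minor_mx x y k l *m
    (\col_i [:: v (ordS k); v (ordS (ordS k));
                w (ordS l); w (ordS (ordS l))]`_i)) j 0 =
  \sum_k x j k * (y j (ordS k) * v k - y j (ordS (ordS k)) * w k)
  - (v k *: vcol x y k + w l *: wcol x y l) j 0.
  rewrite (eq_bigr (fun k => x j k * y j (ordS k) * v k
                           - x j k * y j (ordS (ordS k)) * w k)); last first.
    by move=> i _; rewrite mulrBr !mulrA.
  rewrite sumrB (sum3 _ k) (sum3 (fun k => _ * w k) l) mxE sum4 !mxE.
  by rewrite !inordK //=; ring.
split=> [e | e j].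
  by apply/colP => j; rewrite E e !mxE sub0r.
move/colP/(_ j): e; rewrite E => /eqP; rewrite [X in _ == X]mxE.
by rewrite -subr_eq0 opprK subrK => /eqP.
Qed.

Lemma pencil0 x y v w k l : \det (minor_mx x y k l) != 0 ->
  in_pencil x y v w -> v k = 0 -> w l = 0 -> (v =1 fun=> 0) /\ (w =1 fun=> 0).
Proof.
move=> d0 /(in_pencil_minor _ _ _ _ k l) + v0 w0.
rewrite v0 w0 !scale0r addr0 oppr0.
move/(congr1 (mulmx (invmx (minor_mx x y k l)))).
rewrite mulmx0 mulKmx ?unitmxE ?unitfE // => /colP e.
split; [apply: (forall3 (k := k)) | apply: (forall3 (k := l))] => //.
- by have := e (inord 0); rewrite !mxE inordK.
- by have := e (inord 1); rewrite !mxE inordK.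
- by have := e (inord 2); rewrite !mxE inordK.
- by have := e (inord 3); rewrite !mxE inordK.
Qed.

(** A zero entry of [v] forces, through the cubic, a zero entry of [w], and
    then [pencil0] kills the whole vector. *)
Lemma pencil_neq0 x y v w :
  (forall k l, \det (minor_mx x y k l) != 0) -> in_pencil x y v w ->
  on_cubic v w -> (exists k, (v k != 0) || (w k != 0)) ->
  forall k, v k != 0 /\ w k != 0.
Proof.
move=> d0 pen cub [i i0].
have nz k l : ~~ ((v k == 0) && (w l == 0)).
  apply/negP => /andP[/eqP vk /eqP wl].
  by have [v0 w0] := pencil0 (d0 k l) pen vk wl; move: i0; rewrite v0 w0 eqxx.
have pv : \prod_k v k != 0.
  apply/eqP => pv0; have /prodf_eq0 [k _ vk] : \prod_k v k == 0 by rewrite pv0.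
  move: pv0; rewrite cub => /eqP/prodf_eq0 [l _ wl].
  by have := nz k l; rewrite vk wl.
move=> k; split; [move: pv | move: pv; rewrite cub].
  by apply: contraNneq => vk; apply/prodf_eq0; exists k; rewrite ?vk.
by apply: contraNneq => wk; apply/prodf_eq0; exists k; rewrite ?wk.
Qed.

Definition cubic_disc (a b c d : K) : K :=
  b ^+ 2 * c ^+ 2 - a * c ^+ 3 *+ 4 - b ^+ 3 * d *+ 4 - a ^+ 2 * d ^+ 2 *+ 27
  + a * b * c * d *+ 18.

(** Cramer's rule without division: with [v_0] and [w_0] equal to [s] and [t]
    times the minor, the other unknowns [v_1], [v_2], [w_1], [w_2] of the
    pencil are [cubic_lin i * s + cubic_cst i * t] for [i] from 0 to 3. *)
Definition cubic_cst x y (i : nat) : K :=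
  - (\adj (minor_mx x y ord0 ord0) *m wcol x y ord0) (inord i) 0.
Definition cubic_lin x y (i : nat) : K :=
  - (\adj (minor_mx x y ord0 ord0) *m vcol x y ord0) (inord i) 0.

(** The discriminant of [s * v_1 * v_2 - w_1 * w_2] as a polynomial in [s], at
    [t = 1]. *)
Definition pencil_disc x y : K :=
  let g := cubic_cst x y in let h := cubic_lin x y in
  cubic_disc (h 0%N * h 1%N) (g 0%N * h 1%N + g 1%N * h 0%N - h 2%N * h 3%N)
     (g 0%N * g 1%N - g 2%N * h 3%N - g 3%N * h 2%N) (- (g 2%N * g 3%N)).

End Pencil.

Lemma cubic_roots (K : closedFieldType) (a b c d : K) :
  a != 0 -> cubic_disc a b c d != 0 ->
  exists r : 'I_3 -> K, injective r /\
    forall t, (a * t ^+ 3 + b * t ^+ 2 + c * t + d == 0) = [exists i, t == r i].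
Proof.
move=> a0 disc0.
pose P := Poly [:: d; c; b; a].
have sP : size P = 4%N by rewrite (@PolyK _ 0).
have lP : lead_coef P = a by rewrite lead_coefE sP coef_Poly.
have [s Ps] := closed_field_poly_normal P.
have := congr1 (size \o val) Ps.
rewrite /= sP lP size_scale // size_prod_XsubC => -[/esym ss].
case: s ss Ps => [|r0 [|r1 [|r2 [|//]]]] // _.
rewrite lP !big_cons big_nil mulr1 => Ps.
have [Ed Ec Eb] : [/\ d = - a * r0 * r1 * r2,
    c = a * (r0 * r1 + r0 * r2 + r1 * r2) & b = - a * (r0 + r1 + r2)].
  have {}Ps : P = Poly [:: - a * r0 * r1 * r2;
      a * (r0 * r1 + r0 * r2 + r1 * r2); - a * (r0 + r1 + r2); a].
    by rewrite Ps /= !cons_poly_def -mul_polyC mul0r add0r; ring.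
  have E i := congr1 (fun q : {poly K} => q`_i) Ps.
  by split; [have := E 0%N | have := E 1%N | have := E 2%N];
    rewrite !coef_Poly.
exists (fun i : 'I_3 => [:: r0; r1; r2]`_i); split=> [i j | t]; last first.
  have -> : a * t ^+ 3 + b * t ^+ 2 + c * t + d =
      a * ((t - r0) * ((t - r1) * (t - r2))) by rewrite Ed Ec Eb; ring.
  rewrite !mulf_eq0 (negbTE a0) !subr_eq0 /=.
  apply/or3P/existsP => [[] /eqP-> | [[[|[|[|//]]] ?] /= /eqP->]].
  - by exists ord0.
  - by exists (ordS ord0).
  - by exists (ordS (ordS ord0)).
  - by constructor 1.
  - by constructor 2.
  - by constructor 3.
have : cubic_disc a b c d =
    a ^+ 4 * ((r0 - r1) * ((r0 - r2) * (r1 - r2))) ^+ 2.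
  by rewrite /cubic_disc Ed Ec Eb; ring.
move=> discE; move: disc0; rewrite discE mulf_eq0 !expf_eq0 /= (negbTE a0) /=.
rewrite !mulf_eq0 !subr_eq0 !negb_or => /and3P[/eqP n01 /eqP n02 /eqP n12].
case: i j => [[|[|[|//]]] ?] [[|[|[|//]]] ?] //= e; try exact: val_inj;
  by [case: n01 | case: n02 | case: n12].
Qed.

Section Param.
Variable K : fieldType.
Implicit Types (x y : 'M[K]_(4, 3)) (v w mu p : 'I_3 -> K).

Definition pencil_v x y (s t : K) : 'I_3 -> K := fun k =>
  [:: \det (minor_mx x y ord0 ord0) * s;
      cubic_lin x y 0 * s + cubic_cst x y 0 * t;
      cubic_lin x y 1 * s + cubic_cst x y 1 * t]`_k.
Definition pencil_w x y (s t : K) : 'I_3 -> K := fun k =>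
  [:: \det (minor_mx x y ord0 ord0) * t;
      cubic_lin x y 2 * s + cubic_cst x y 2 * t;
      cubic_lin x y 3 * s + cubic_cst x y 3 * t]`_k.

Lemma pencil_param_in x y s t :
  in_pencil x y (pencil_v x y s t) (pencil_w x y s t).
Proof.
apply/(in_pencil_minor _ _ _ _ ord0 ord0).
set M := minor_mx x y ord0 ord0.
have -> : \col_i [:: pencil_v x y s t (ordS ord0);
    pencil_v x y s t (ordS (ordS ord0)); pencil_w x y s t (ordS ord0);
    pencil_w x y s t (ordS (ordS ord0))]`_i =
  - (\adj M *m (s *: vcol x y ord0 + t *: wcol x y ord0)).
  apply/colP => i; rewrite mulmxDr -!scalemxAr.
  have linE : cubic_lin x y i = - (\adj M *m vcol x y ord0) i 0.
    by rewrite /cubic_lin inord_val.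
  have cstE : cubic_cst x y i = - (\adj M *m wcol x y ord0) i 0.
    by rewrite /cubic_cst inord_val.
  move: (\adj M *m _) (\adj M *m _) linE cstE => V W.
  rewrite !mxE opprD -!mulrN ![_ * - _]mulrC => <- <-.
  by rewrite /pencil_v /pencil_w; case: i => [[|[|[|[|//]]]] lti].
rewrite mulmxN mulmxA mul_mx_adj mul_scalar_mx scalerDr !scalerA.
by congr (- (_ + _)); congr (_ *: _).
Qed.

Lemma pencil_paramE x y v w : \det (minor_mx x y ord0 ord0) != 0 ->
  in_pencil x y v w ->
  exists s t, v =1 pencil_v x y s t /\ w =1 pencil_w x y s t.
Proof.
move=> D0 pen; set D := \det _ in D0.
pose s := v ord0 / D; pose t := w ord0 / D; exists s, t.
have vE : v ord0 = pencil_v x y s t ord0.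
  by rewrite /pencil_v /= -/D mulrC divfK.
have wE : w ord0 = pencil_w x y s t ord0.
  by rewrite /pencil_w /= -/D mulrC divfK.
pose dv k := v k - pencil_v x y s t k; pose dw k := w k - pencil_w x y s t k.
have [||| v0 w0] := @pencil0 _ x y dv dw ord0 ord0 D0; last first.
- by split=> k; apply/eqP; rewrite -subr_eq0; apply/eqP;
    [exact: v0 | exact: w0].
- by rewrite /dw -wE subrr.
- by rewrite /dv -vE subrr.
move=> j; have := congr2 +%R (pen j) (congr1 -%R (pencil_param_in x y s t j)).
rewrite subrr -sumrB; apply: etrans; apply: eq_bigr => k _.
by rewrite /dv /dw; ring.
Qed.

Lemma pencil_cubic x y s :
  on_cubic (pencil_v x y s 1) (pencil_w x y s 1) <->
  let g := cubic_cst x y in let h := cubic_lin x y in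
  \det (minor_mx x y ord0 ord0) * (h 0 * h 1 * s ^+ 3 +
   (g 0 * h 1 + g 1 * h 0 - h 2 * h 3) * s ^+ 2 +
   (g 0 * g 1 - g 2 * h 3 - g 3 * h 2) * s + - (g 2 * g 3)) = 0.
Proof.
rewrite /on_cubic !big_ord_recl !big_ord0 /pencil_v /pencil_w /=.
split=> e.
  move/eqP: e; rewrite -subr_eq0 => /eqP <-; ring.
by apply/eqP; rewrite -subr_eq0; apply/eqP; rewrite -[RHS]e; ring.
Qed.

End Param.

(** The common zeros of the pencil and the cubic have [w_0] nonzero, so up to
    scale they are the pencil members with [t = 1] and [s] a root of a cubic
    polynomial, of degree exactly three thanks to two of the minors. *)
Lemma pencil_points (K : closedFieldType) (x y : 'M[K]_(4, 3)) :
  (forall k l, \det (minor_mx x y k l) != 0) -> pencil_disc x y != 0 ->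
  exists v w : 'I_3 -> 'I_3 -> K,
  [/\ forall r, in_pencil x y (v r) (w r) /\ on_cubic (v r) (w r),
      forall r k, v r k != 0 /\ w r k != 0,
      forall r s, v r ord0 * w s ord0 = v s ord0 * w r ord0 -> r = s &
      forall v' w', in_pencil x y v' w' -> on_cubic v' w' ->
        (exists k, (v' k != 0) || (w' k != 0)) ->
        exists r c, [/\ c != 0, forall k, v' k = c * v r k &
                       forall k, w' k = c * w r k]].
Proof.
move=> M0 disc0; have D0 := M0 ord0 ord0.
(* At [s = 1] and [t = 0] the unknown [w_0] is zero while [v_0] is not, so
   by [pencil0] neither [v_1] nor [v_2] can be zero.
   These two are the factors of the leading coefficient. *)
have lead0 : cubic_lin x y 0 * cubic_lin x y 1 != 0.
  have pen := pencil_param_in x y 1 0.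
  rewrite mulf_eq0 negb_or; apply/andP; split; apply/eqP => h0.
  - have [] // := pencil0 (M0 (ordS ord0) ord0) pen.
    + by rewrite /pencil_v /= h0 !(mul0r, mulr0, addr0).
    + by rewrite /pencil_w /= mulr0.
    by move/(_ ord0)/eqP; rewrite /pencil_v /= mulr1 (negbTE D0).
  - have [] // := pencil0 (M0 (ordS (ordS ord0)) ord0) pen.
    + by rewrite /pencil_v /= h0 !(mul0r, mulr0, addr0).
    + by rewrite /pencil_w /= mulr0.
    by move/(_ ord0)/eqP; rewrite /pencil_v /= mulr1 (negbTE D0).
have [r [r_inj rE]] := cubic_roots lead0 disc0.
have cub i : on_cubic (pencil_v x y (r i) 1) (pencil_w x y (r i) 1).
  apply/pencil_cubic => g h; apply/eqP; rewrite mulf_eq0; apply/orP; right.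
  by rewrite rE; apply/existsP; exists i.
exists (fun i => pencil_v x y (r i) 1), (fun i => pencil_w x y (r i) 1).
split=> [i | i | i j | v w pen vw_cub vw0].
- by split; first exact: pencil_param_in.
- apply: (pencil_neq0 M0 (pencil_param_in _ _ _ _) (cub i)); exists ord0.
  by rewrite orbC /pencil_w /= mulr1 D0.
- rewrite /pencil_v /pencil_w /= !mulr1 => /(mulIf D0)/(mulfI D0); exact: r_inj.
have vw_n0 := pencil_neq0 M0 pen vw_cub vw0.
have [s [t [vE wE]]] := pencil_paramE D0 pen.
have t0 : t != 0.
  have [_] := vw_n0 ord0; rewrite wE /pencil_w /=; apply: contraNneq => ->.
  by rewrite mulr0.
have vE' k : v k = t * pencil_v x y (s / t) 1 k.
  rewrite vE /pencil_v; case: k => [[|[|[|//]]] ?] /=; by field.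
have wE' k : w k = t * pencil_w x y (s / t) 1 k.
  rewrite wE /pencil_w; case: k => [[|[|[|//]]] ?] /=; by field.
have : on_cubic (pencil_v x y (s / t) 1) (pencil_w x y (s / t) 1).
  move: vw_cub; rewrite /on_cubic (eq_bigr _ (fun k _ => vE' k)).
  rewrite (eq_bigr _ (fun k _ => wE' k)) !big_split /= !prodr_const.
  by apply: mulfI; rewrite expf_neq0.
move/pencil_cubic => /= /eqP; rewrite mulf_eq0 (negbTE D0) /= rE.
by case/existsP => i /eqP ri; exists i, t; rewrite -ri.
Qed.

(** * From points of the cubic to solutions *)

Section Solutions.
Variable K : fieldType.
Implicit Types (x y : 'M[K]_(4, 3)) (v w mu p : 'I_3 -> K) (lam be : 'I_4 -> K).

Definition solves x y lam be mu p : Prop :=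
  forall j k, y j k * mu k = lam j * x j k + be j * p k.

(** The products of an entry of [mu] and an entry of [p] of different indices,
    split by the cyclic orientation of the pair of indices. *)
Definition vprod mu p : 'I_3 -> K := fun k => mu (ordS k) * p (ordS (ordS k)).
Definition wprod mu p : 'I_3 -> K := fun k => mu (ordS (ordS k)) * p (ordS k).

Lemma in_pencil_cross x y mu p j :
  \sum_k x j k * (y j (ordS k) * vprod mu p k
                   - y j (ordS (ordS k)) * wprod mu p k)
  = \sum_k x j k * cross (fun k => y j k * mu k) p k.
Proof. by apply: eq_bigr => k _; rewrite /cross !mulrA. Qed.

Lemma solves_in_pencil x y lam be mu p : solves x y lam be mu p ->
  in_pencil x y (vprod mu p) (wprod mu p).
Proof. by move=> sol j; rewrite in_pencil_cross (cross_comb (sol j)). Qed.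

Lemma on_cubic_prod mu p : on_cubic (vprod mu p) (wprod mu p).
Proof.
rewrite /on_cubic /vprod /wprod !big_ord_recl !big_ord0.
have o2 : lift ord0 (lift ord0 ord0) = ordS (ordS ord0) :> 'I_3.
  exact: val_inj.
have o3 : lift ord0 ord0 = ordS ord0 :> 'I_3 by exact: val_inj.
by rewrite o2 o3 !ordS3; ring.
Qed.

(** With [p_0 = 1] the other entries of [mu] and [p] are read off from five of
    the six products; the cubic relation is what the sixth one requires. *)
Lemma prod_of_cubic v w : (forall k, v k != 0 /\ w k != 0) -> on_cubic v w ->
  exists mu p, [/\ forall k, mu k != 0, forall k, p k != 0,
     v =1 vprod mu p & w =1 wprod mu p].
Proof.
move=> vw0; rewrite /on_cubic !big_ord_recl !big_ord0 !mulr1.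
have o2 : lift ord0 (lift ord0 ord0) = ordS (ordS ord0) :> 'I_3.
  exact: val_inj.
have o3 : lift ord0 ord0 = ordS ord0 :> 'I_3 by exact: val_inj.
rewrite o2 o3.
have [v0 w0] := vw0 ord0; have [v1 w1] := vw0 (ordS ord0).
have [v2 w2] := vw0 (ordS (ordS ord0)).
set a0 := v ord0 in v0 *; set a1 := v (ordS ord0) in v1 *.
set a2 := v (ordS (ordS ord0)) in v2 *.
set b0 := w ord0 in w0 *; set b1 := w (ordS ord0) in w1 *.
set b2 := w (ordS (ordS ord0)) in w2 *.
move=> e.
exists (fun k => [:: b1 * b2 / a0; b2; a1]`_k),
       (fun k => [:: 1; b0 / a1; a0 / b2]`_k); split.
- by apply: (forall3 (k := ord0)); rewrite /= ?mulf_neq0 ?invr_neq0.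
- by apply: (forall3 (k := ord0)); rewrite /= ?oner_neq0 ?mulf_neq0 ?invr_neq0.
- apply: (forall3 (k := ord0)); rewrite /vprod /= -?/a0 -?/a1 -?/a2.
  + by field.
  + by rewrite mulr1.
  + apply: (mulfI v1); apply: (mulfI v0); rewrite e.
    by field; apply/andP.
- apply: (forall3 (k := ord0)); rewrite /wprod /= -?/b0 -?/b1 -?/b2.
  + by field.
  + by field; apply/andP.
  + by rewrite mulr1.
Qed.

(** If [p] is parallel to [x j], the relations of the other three rows become
    linear in [mu], with this matrix; see [align_x]. With [x] and [y] exchanged
    it governs the products of two entries of [mu] when [p] is parallel to
    [mu * y j]; see [align_y]. *)
Definition align_det x y (j : 'I_4) : K :=
  \det (\matrix_(i < 3, l < 3) (y (lift j i) l * cross (x j) (x (lift j i)) l)).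

Lemma align_det_eq0 x y j (m : 'I_3 -> K) : align_det x y j != 0 ->
  (forall i, \sum_l y i l * cross (x j) (x i) l * m l = 0) -> m =1 fun=> 0.
Proof.
rewrite /align_det; set A := \matrix_(i, l) _ => D0 e.
have : A *m \col_l m l = 0.
  apply/colP => i; rewrite !mxE -[RHS](e (lift j i)); apply: eq_bigr => l _.
  by rewrite !mxE.
move/(congr1 (mulmx (invmx A))); rewrite mulmx0 mulKmx ?unitmxE ?unitfE //.
by move=> /colP m0 l; have := m0 l; rewrite !mxE.
Qed.

Lemma cross_eq0 (x z : 'I_3 -> K) : (forall k, z k != 0) ->
  (forall k, cross x z k = 0) -> exists c, forall k, x k = c * z k.
Proof.
move=> z0 e; exists (x ord0 / z ord0); apply: (forall3 (k := ord0)).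
- by rewrite divfK.
- apply: (mulIf (z0 ord0)); have := e (ordS (ordS ord0)).
  rewrite /cross !ordS3 => /eqP; rewrite subr_eq0 => /eqP e1.
  by rewrite mulrAC divfK // e1.
- apply: (mulIf (z0 ord0)); have := e (ordS ord0).
  rewrite /cross !ordS3 => /eqP; rewrite subr_eq0 => /eqP e1.
  by rewrite mulrAC divfK // e1.
Qed.

Lemma align_x x y mu p j : align_det x y j != 0 ->
  in_pencil x y (vprod mu p) (wprod mu p) ->
  (forall k, mu k != 0) -> (forall k, p k != 0) ->
  exists k, cross (x j) p k != 0.
Proof.
move=> D0 pen mu0 p0.
have [k xp_k | /= xp0] := pickP (fun k => cross (x j) p k != 0).
  by exists k.
have [|c xE] := @cross_eq0 (x j) p p0.
  by move=> k; apply/eqP/negPn; rewrite xp0.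
suff /(align_det_eq0 D0)/(_ ord0)/eqP :
    forall i, \sum_l y i l * cross (x j) (x i) l * mu l = 0.
  by rewrite (negbTE (mu0 _)).
move=> i; have := congr1 ( *%R c) (pen i); rewrite mulr0 => pen_i.
apply: etrans pen_i; rewrite in_pencil_cross !(sum3 _ ord0) /cross !ordS3.
by rewrite !xE; ring.
Qed.

Lemma align_y x y mu p j : align_det y x j != 0 ->
  in_pencil x y (vprod mu p) (wprod mu p) ->
  (forall k, mu k != 0) -> (forall k, p k != 0) ->
  exists k, cross (fun k => y j k * mu k) p k != 0.
Proof.
move=> D0 pen mu0 p0; pose z i k := y i k * mu k.
have [k zp_k | /= zp0] := pickP (fun k => cross (z j) p k != 0).
  by exists k.
have [|c zE] := @cross_eq0 (z j) p p0.
  by move=> k; apply/eqP/negPn; rewrite zp0.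
suff /(align_det_eq0 D0)/(_ ord0)/eqP : forall i,
    \sum_l x i l * cross (y j) (y i) l * (mu (ordS l) * mu (ordS (ordS l))) = 0.
  by rewrite mulf_eq0 !(negbTE (mu0 _)).
move=> i; have e : \sum_l x i l * cross (z i) (z j) l = 0.
  rewrite (eq_bigr (fun l => c * (x i l * cross (z i) p l))).
    by rewrite -mulr_sumr -in_pencil_cross pen mulr0.
  by move=> l _; rewrite /cross !zE; ring.
rewrite -[RHS]oppr0 -[X in - X]e -sumrN; apply: eq_bigr => l _.
by rewrite /cross /z; ring.
Qed.

(** Row [j] of the pencil is a linear dependency between [x j], [mu * y j] and
    [p]. As [x j] and [p] are independent it can be solved for [mu * y j], and
    [lam j] is nonzero because [mu * y j] is not parallel to [p]. *)
Lemma solves_exists x y mu p :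
  (forall j, align_det x y j != 0) -> (forall j, align_det y x j != 0) ->
  in_pencil x y (vprod mu p) (wprod mu p) ->
  (forall k, mu k != 0) -> (forall k, p k != 0) ->
  exists lam be, solves x y lam be mu p /\ forall j, lam j != 0.
Proof.
move=> Dx Dy pen mu0 p0.
suff /fin_all_exists2[f E f0] : forall j, exists2 st : K * K,
    forall k, y j k * mu k = st.1 * x j k + st.2 * p k & st.1 != 0.
  by exists (fun j => (f j).1), (fun j => (f j).2).
move=> j; have [k xp0] := align_x (Dx j) pen mu0 p0.
have [|s [t E]] := comb_of_cross (z := fun k => y j k * mu k) xp0.
  by rewrite -in_pencil_cross pen.
exists (s, t) => //=; have [l] := align_y (Dy j) pen mu0 p0.
apply: contraNneq => s0; apply/eqP.
by rewrite /cross !E s0 !mul0r !add0r; ring.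
Qed.

(** Ratios of the products give the ratios of the entries of [p] and then those
    of [mu]; comparing the expressions of [mu * y j] in the independent vectors
    [x j] and [p] gives [lam j] and [be j]. *)
Lemma solves_unique x y lam be mu p lam' be' mu' p' c :
  (forall j, align_det x y j != 0) ->
  solves x y lam be mu p -> solves x y lam' be' mu' p' ->
  (forall k, mu k != 0) -> (forall k, p k != 0) -> c != 0 ->
  (forall k, vprod mu' p' k = c * vprod mu p k) ->
  (forall k, wprod mu' p' k = c * wprod mu p k) ->
  exists s t, [/\ s != 0, t != 0, forall j, lam' j = s * lam j &
                  forall j, be' j = t * be j].
Proof.
move=> Dx sol sol' mu0 p0 c0 vE wE.
pose r := p' ord0 / p ord0; pose s := c / r.
have mp' k : mu' k != 0 /\ p' k != 0.
  have : vprod mu' p' (ordS k) != 0 by rewrite vE !mulf_neq0.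
  have : vprod mu' p' (ordS (ordS k)) != 0 by rewrite vE !mulf_neq0.
  by rewrite /vprod !ordS3 !mulf_eq0 !negb_or => /andP[-> _] /andP[_ ->].
have r0 : r != 0 by rewrite mulf_neq0 ?invr_neq0 //; have [] := mp' ord0.
have pr k : p' k * p (ordS k) = p' (ordS k) * p k.
  have [m0 _] := mp' (ordS (ordS k)).
  apply: (mulfI (mulf_neq0 m0 (mulf_neq0 c0 (mu0 (ordS (ordS k)))))).
  have := congr2 *%R (vE (ordS k)) (esym (wE k)); rewrite /vprod /wprod !ordS3.
  set m' := mu' _; set m := mu _ => e.
  transitivity (m' * p' k * (c * (m * p (ordS k)))); first by ring.
  by rewrite e; ring.
have pE : forall k, p' k = r * p k.
  have o0 : p ord0 != 0 := p0 _.
  apply: (forall3 (k := ord0)); first by rewrite /r divfK.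
    by apply: (mulIf o0); rewrite -pr /r; field.
  apply: (mulIf o0); have := pr (ordS (ordS ord0)); rewrite ordS3 => ->.
  by rewrite /r; field.
have muE k : mu' k = s * mu k.
  have := vE (ordS (ordS k)); rewrite /vprod ordS3 pE => e.
  apply: (mulIf (mulf_neq0 r0 (p0 (ordS k)))); rewrite e /s; by field.
exists s, (s / r); rewrite /s.
have s0 : s != 0 by rewrite mulf_neq0 ?invr_neq0.
suff E j : lam' j = s * lam j /\ be' j = s / r * be j.
  split; rewrite ?mulf_neq0 ?invr_neq0 // => j; by have [] := E j.
have [k xp0] := align_x (Dx j) (solves_in_pencil sol) mu0 p0.
have e k' : (lam' j - s * lam j) * x j k' + (be' j * r - s * be j) * p k' = 0.
  have := sol' j k'; rewrite muE pE mulrCA sol => e.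
  transitivity (lam' j * x j k' + be' j * (r * p k') -
    s * (lam j * x j k' + be j * p k')); first by ring.
  by rewrite -e subrr.
have l0 := cross_indep xp0 e.
split; first by apply/eqP; rewrite -subr_eq0 l0.
have := e k; rewrite l0 mul0r add0r => /eqP.
rewrite mulf_eq0 (negbTE (p0 k)) orbF subr_eq0 => /eqP be'E.
by apply: (mulIf r0); rewrite be'E; field.
Qed.

End Solutions.

Section Centers.
Variable K : fieldType.
Implicit Types (x y : 'M[K]_(4, 3)) (v w mu p : 'I_3 -> K) (lam be : 'I_4 -> K).

(** If [p] were zero, all [y j k * mu k] would equal [lam j * x j k], so
    [be = 0] and an arbitrary [p] would give a solution as well. A basis vector
    for [p] then yields a nonzero pencil member with zero entries in both [v]
    and [w]. *)
Lemma solves_neq0 x y lam be mu p :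
  (forall k l, \det (minor_mx x y k l) != 0) ->
  solves x y lam be mu p -> (forall k, mu k != 0) ->
  exists k, (vprod mu p k != 0) || (wprod mu p k != 0).
Proof.
move=> M0 sol mu0.
have [k pk | /= p0] := pickP (fun k => p k != 0).
  by exists (ordS k); rewrite /vprod ordS3 mulf_neq0.
pose e : 'I_3 -> K := fun k => (k == ordS (ordS ord0))%:R.
have sol' : solves x y lam (fun=> 0) mu e.
  move=> j k; rewrite sol mul0r; congr (_ + _).
  by have /negbFE/eqP-> := p0 k; rewrite mulr0.
have [||v0 _] := pencil0 (M0 (ordS ord0) ord0) (solves_in_pencil sol').
- by rewrite /vprod /e ordS3 mulr0.
- by rewrite /wprod /e mulr0.
by move: (v0 ord0) => /eqP; rewrite /vprod /e eqxx mulr1 (negbTE (mu0 _)).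
Qed.

(** The planes through the line of the first two points and, respectively, the
    third, fourth, fifth and sixth points have the cross-ratio
    [x_20 x_31 / (x_30 x_21)]. *)
Definition cross_ratio_neq x y : bool :=
  x (inord 2) ord0 * x (inord 3) (ordS ord0) *
    (y (inord 3) ord0 * y (inord 2) (ordS ord0)) !=
  x (inord 3) ord0 * x (inord 2) (ordS ord0) *
    (y (inord 2) ord0 * y (inord 3) (ordS ord0)).

(** The vanishing of two entries of [be] puts the center on the line through
    the first two points. Projecting the common picture from the image of that
    line then identifies the two pencils of planes, so the cross-ratios
    agree. *)
Lemma cross_ratio_base x y lam be mu p : cross_ratio_neq x y ->
  solves x y lam be mu p -> (forall j, lam j != 0) -> (forall k, mu k != 0) ->
  be (inord 2) = 0 -> be (inord 3) <> 0.
Proof.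
move=> /eqP cr sol lam0 mu0 b2 b3; apply: cr.
have E j k : be j = 0 -> y j k * mu k = lam j * x j k.
  by move=> bj; rewrite sol bj mul0r addr0.
have d0 : lam (inord 2) * lam (inord 3) * (mu ord0 * mu (ordS ord0)) != 0.
  by rewrite !mulf_neq0.
apply: (mulfI d0).
transitivity ((lam (inord 2) * x (inord 2) ord0)
  * (lam (inord 3) * x (inord 3) (ordS ord0))
  * ((y (inord 3) ord0 * mu ord0)
  * (y (inord 2) (ordS ord0) * mu (ordS ord0)))); first by ring.
by rewrite -2?E // !E //; rewrite -2?E //; ring.
Qed.

(** In the frame of the first four points: [be] is on no line joining two of
    these, nor on a line joining one of these with one of the last three. *)
Definition off_secants y be : Prop :=
  (forall i j, i != j -> be i = 0 -> be j <> 0) /\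
  (forall k i c, exists2 j, j != i & be j <> c * y j k).

(** Equal centers make [lam'] proportional to [lam] at the indices where [be]
    is nonzero. Subtracting the two systems there leaves, for each column [k],
    a relation between that column of [y] and [be]: if [mu'] were not
    proportional to [mu], then [be] would be on a secant line. *)
Lemma same_centers x y lam be mu p lam' be' mu' p' c d :
  (forall j k, y j k != 0) ->
  off_secants y be ->
  solves x y lam be mu p -> solves x y lam' be' mu' p' ->
  (forall j, lam j != 0) -> (forall j, lam' j != 0) -> c != 0 -> d != 0 ->
  (forall j, be' j = c * be j) ->
  (forall j, be' j / lam' j = d * (be j / lam j)) ->
  exists2 e, e != 0 & (forall k, vprod mu' p' k = e * vprod mu p k) /\
     (forall k, wprod mu' p' k = e * wprod mu p k).
Proof.
move=> y0 [off1 off2] sol sol' lam0 lam0' c0 d0 beE aE.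
(* The expected ratio of [lam'] to [lam] and of [mu'] to [mu]. *)
pose s := c / d; have s0 : s != 0 by rewrite mulf_neq0 ?invr_neq0.
have lamE j : be j != 0 -> lam' j = s * lam j.
  move=> bj; have := aE j; rewrite beE => e.
  apply: (mulfI (mulf_neq0 d0 (mulf_neq0 bj (invr_neq0 (lam0 j))))).
  apply: (mulIf (invr_neq0 (lam0' j))).
  rewrite -mulrA mulfV // mulr1 -[LHS]e /s; field.
  by rewrite d0 lam0 lam0'.
have E j k : be j != 0 ->
    y j k * (mu' k - s * mu k) = be j * (c * p' k - s * p k).
  move=> bj; rewrite !mulrBr (mulrCA _ s) sol sol' beE lamE //; by ring.
have muE k : mu' k = s * mu k.
  apply/eqP; rewrite -subr_eq0; apply: contraT => m0.
  (* At most one entry of [be] is zero; the other three suffice for [off2]. *)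
  have [i bi0 | nz] := pickP (fun i => be i == 0).
    have bj0 j : j != i -> be j != 0.
      by move=> ji; apply/eqP; apply: (off1 i); rewrite 1?eq_sym //; apply/eqP.
    have p0 : c * p' k - s * p k != 0.
      have [j ji] : exists j, j != i.
        by exists (lift i ord0); rewrite eq_sym neq_lift.
      have := E j k (bj0 j ji); move: (mulf_neq0 (y0 j k) m0) => /[swap] ->.
      by rewrite mulf_eq0 negb_or => /andP[].
    have [j ji] := off2 k i ((mu' k - s * mu k) / (c * p' k - s * p k)).
    case; apply: (mulIf p0); rewrite -E ?bj0 //; by field.
  have bj0 j : be j != 0 by rewrite nz.
  have p0 : c * p' k - s * p k != 0.
    have := E ord0 k (bj0 _); move: (mulf_neq0 (y0 ord0 k) m0) => /[swap] ->.
    by rewrite mulf_eq0 negb_or => /andP[].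
  have [j ji] := off2 k ord0 ((mu' k - s * mu k) / (c * p' k - s * p k)).
  case; apply: (mulIf p0); rewrite -E ?bj0 //; by field.
have pE k : p' k = s / c * p k.
  have [j bj] : exists j, be j != 0.
    have [b0|b0] := eqVneq (be ord0) 0; last by exists ord0.
    by exists (lift ord0 ord0); apply/eqP; apply: (off1 ord0).
  have := E j k bj; rewrite muE subrr mulr0 => /esym/eqP.
  rewrite mulf_eq0 (negbTE bj) subr_eq0 => /eqP e.
  apply: (mulfI c0); rewrite e; by field.
exists (s * (s / c)); first by rewrite !mulf_neq0 ?invr_neq0.
by split=> k; rewrite /vprod /wprod muE pE; ring.
Qed.

Definition regular x y : Prop :=
  [/\ forall k l, \det (minor_mx x y k l) != 0, pencil_disc x y != 0,
      forall j, align_det x y j != 0, forall j, align_det y x j != 0 &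
      forall j k, y j k != 0].

End Centers.

(** The solutions come from the three roots of the cubic. They are told apart
    by their centers only when [be r] is off the secant lines, since otherwise
    the centers need not determine [lam r]. *)
Theorem three_solutions (K : closedFieldType) (x y : 'M[K]_(4, 3)) :
  regular x y ->
  exists lam be : 'I_3 -> 'I_4 -> K, exists mu p : 'I_3 -> 'I_3 -> K,
  [/\ forall r, [/\ solves x y (lam r) (be r) (mu r) (p r),
        forall j, lam r j != 0 & forall k, mu r k != 0],
      forall lam' be' mu' p', solves x y lam' be' mu' p' ->
        (forall j, lam' j != 0) -> (forall k, mu' k != 0) ->
        exists r s t, [/\ s != 0, t != 0, forall j, lam' j = s * lam r j &
                  forall j, be' j = t * be r j] &
      forall r s c d, off_secants y (be r) -> c != 0 -> d != 0 ->
        (forall j, be s j = c * be r j) ->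
        (forall j, be s j / lam s j = d * (be r j / lam r j)) -> r = s].
Proof.
move=> [M0 disc0 Dx Dy y0].
have [v [w [pen vw0 vw_inj vw_all]]] := pencil_points M0 disc0.
have /fin_all_exists[f F] : forall r, exists f :
      ('I_4 -> K) * ('I_4 -> K) * ('I_3 -> K) * ('I_3 -> K),
    [/\ solves x y f.1.1.1 f.1.1.2 f.1.2 f.2,
        forall j, f.1.1.1 j != 0, forall k, f.1.2 k != 0, forall k, f.2 k != 0 &
        v r =1 vprod f.1.2 f.2 /\ w r =1 wprod f.1.2 f.2].
  move=> r; have [pen_r cub_r] := pen r.
  have [mu [p [mu0 p0 vE wE]]] := prod_of_cubic (vw0 r) cub_r.
  have pen' : in_pencil x y (vprod mu p) (wprod mu p).
    move=> j; rewrite -[RHS](pen_r j); apply: eq_bigr => k _; by rewrite vE wE.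
  have [lam [be [sol lam0]]] := solves_exists Dx Dy pen' mu0 p0.
  by exists (lam, be, mu, p).
exists (fun r => (f r).1.1.1), (fun r => (f r).1.1.2).
exists (fun r => (f r).1.2), (fun r => (f r).2).
split=> [r | lam be mu p sol lam0 mu0 | r s c d off c0 d0 beE aE].
- by have [? ? ?] := F r.
- have [r [c [c0 vE wE]]] := vw_all _ _ (solves_in_pencil sol)
    (on_cubic_prod mu p) (solves_neq0 M0 sol mu0).
  have [sol_r lam_r mu_r p_r [v_r w_r]] := F r.
  have [||s [t []]] := solves_unique Dx sol_r sol mu_r p_r c0.
  + by move=> k; rewrite vE v_r.
  + by move=> k; rewrite wE w_r.
  by exists r, s, t.
- have [sol_r lam_r mu_r p_r [v_r w_r]] := F r.
  have [sol_s lam_s mu_s p_s [v_s w_s]] := F s.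
  have [e e0 [vE wE]] :=
    same_centers y0 off sol_r sol_s lam_r lam_s c0 d0 beE aE.
  by apply: vw_inj; rewrite v_r w_s v_s w_r vE wE; ring.
Qed.

(** * Cameras and solutions *)

Section Cameras.
Variable K : fieldType.
Implicit Types (X Y : 'M[K]_(4, 4 + 3)) (A B : 'M[K]_(3, 4)).
Implicit Types kap : 'I_(4 + 3) -> K.

Definition same_images X Y A B kap : Prop :=
  forall i, A *m col i X = kap i *: (B *m col i Y).

(** Coordinates of the last three points in the frame of the first four. The
    adjugate keeps them polynomial in [X]; compared with the inverse it only
    rescales each point. *)
Definition affine_coords X : 'M[K]_(4, 3) := \adj (lsubmx X) *m rsubmx X.

Lemma affine_coords_col X k : lsubmx X *m col k (affine_coords X) =
  \det (lsubmx X) *: col (rshift 4 k) X.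
Proof.
rewrite [col k _]colE 2!mulmxA mul_mx_adj mul_scalar_mx -scalemxAl -colE.
by congr (_ *: _); apply/colP => j; rewrite !mxE.
Qed.

Lemma base_col X j : lsubmx X *m col j 1%:M = col (lshift 3 j) X.
Proof.
by rewrite [col j 1%:M]colE mul1mx -colE; apply/colP => l; rewrite !mxE.
Qed.

Lemma same_images_base X Y A B kap (v : 'cV[K]_4) : same_images X Y A B kap ->
  A *m (lsubmx X *m v) = B *m (lsubmx Y *m \col_j (kap (lshift 3 j) * v j 0)).
Proof.
move=> im; have E : A *m lsubmx X =
    B *m lsubmx Y *m diag_mx (\row_j kap (lshift 3 j)).
  rewrite mul_mx_diag; apply/matrixP => i j.
  rewrite [RHS]mxE [X in _ * X]mxE mulrC.
  have := congr1 (fun v : 'cV_3 => v i 0) (im (lshift 3 j)); rewrite [RHS]mxE.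
  rewrite !mxE => e; transitivity (\sum_j0 A i j0 * col (lshift 3 j) X j0 0).
    by apply: eq_bigr => l _; rewrite !mxE.
  rewrite e; congr (_ * _); by apply: eq_bigr => l _; rewrite !mxE.
rewrite mulmxA E -!mulmxA; congr (_ *m (_ *m _)).
by rewrite mul_diag_mx; apply/colP => j; rewrite !mxE.
Qed.

Lemma ker_line B (b v : 'cV[K]_4) : \rank B = 3%N -> b != 0 ->
  B *m b = 0 -> B *m v = 0 -> exists c, v = c *: b.
Proof.
move=> rB b0 Bb Bv.
have inK (u : 'cV_4) : B *m u = 0 -> (u^T <= kermx B^T)%MS.
  by move=> Bu; rewrite sub_kermx -trmx_mul Bu trmx0.
have rb : \rank b^T = 1%N by rewrite rank_rV trmx_eq0 b0.
have : (kermx B^T <= b^T)%MS.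
  rewrite -(geq_leqif (mxrank_leqif_sup (inK b Bb))).
  by rewrite mxrank_ker mxrank_tr rB rb.
move/(submx_trans (inK v Bv))/sub_rVP => [c vE]; exists c.
by apply: trmx_inj; rewrite vE linearZ.
Qed.

Lemma rank3_kernel (b : 'cV[K]_4) : b != 0 ->
  exists2 B : 'M[K]_(3, 4), \rank B = 3%N & B *m b = 0.
Proof.
move=> b0; have rk : \rank (kermx b) = 3%N.
  by rewrite mxrank_ker -mxrank_tr rank_rV trmx_eq0 b0.
have : row_base (kermx b) *m b = 0.
  by apply/eqP; rewrite -sub_kermx eq_row_base.
move: (row_base_free (kermx b)) => /eqP.
by move: (row_base (kermx b)); rewrite rk => B rB Bb; exists B.
Qed.

(** With [P], [Q] the first four columns, the first four points give
    [A P = B Q diag(lam)]. Applied to column [k] of [x], this shows that [B Q]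
    kills [mu_k y_k - lam * x_k], which is hence a multiple [p_k] of [be]. *)
Lemma solves_of_cameras X Y A B kap (be : 'cV[K]_4) :
  \det (lsubmx X) != 0 -> \det (lsubmx Y) != 0 ->
  \rank B = 3%N -> (forall i, kap i != 0) -> same_images X Y A B kap ->
  be != 0 -> B *m (lsubmx Y *m be) = 0 ->
  exists mu p, (forall k, mu k != 0) /\
    solves (affine_coords X) (affine_coords Y) (fun j => kap (lshift 3 j))
      (fun j => be j 0) mu p.
Proof.
move=> dX dY rB kap0 im be0 Bbe.
have uY : lsubmx Y \in unitmx by rewrite unitmxE unitfE.
pose x := affine_coords X; pose y := affine_coords Y.
pose mu k := \det (lsubmx X) * kap (rshift 4 k) / \det (lsubmx Y).
have mu0 k : mu k != 0 by rewrite !mulf_neq0 ?invr_neq0.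
have Q0 : lsubmx Y *m be != 0.
  by apply: contraNneq be0 => e; rewrite -(mulKmx uY be) e mulmx0.
have E k : exists c,
    mu k *: col k y - \col_j (kap (lshift 3 j) * x j k) = c *: be.
  have [|c cE] := ker_line (v := lsubmx Y *m
      (mu k *: col k y - \col_j (kap (lshift 3 j) * x j k))) rB Q0 Bbe.
    have := same_images_base (col k x) im.
    rewrite affine_coords_col -scalemxAr im => e.
    rewrite !mulmxBr -!scalemxAr affine_coords_col -scalemxAr !scalerA divfK //.
    apply/eqP; rewrite -scalerA subr_eq0 e; apply/eqP.
    congr (_ *m (_ *m _)); apply/colP => j.
    by rewrite !mxE.
  by exists c; rewrite -(mulKmx uY (_ - _)) cE -scalemxAr mulKmx.
have [p pE] := fin_all_exists E.
exists mu, p; split=> // j k; rewrite -/x -/y; clearbody x y.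
have := congr1 (fun v : 'cV_4 => v j 0) (pE k); rewrite !mxE => e.
by rewrite addrC [be j 0 * _]mulrC -e subrK mulrC.
Qed.

(** Any [B0] of rank three with kernel [be] yields the cameras
    [B0 diag(lam) P^-1] and [B0 Q^-1], where [P], [Q] are the first four
    columns. *)
Lemma cameras_of_solves X Y lam (be : 'cV[K]_4) mu p :
  \det (lsubmx X) != 0 -> \det (lsubmx Y) != 0 ->
  solves (affine_coords X) (affine_coords Y) lam (fun j => be j 0) mu p ->
  (forall j, lam j != 0) -> (forall k, mu k != 0) -> be != 0 ->
  exists A B kap, [/\ \rank A = 3%N /\ \rank B = 3%N, forall i, kap i != 0,
    same_images X Y A B kap, A *m (lsubmx X *m \col_j (be j 0 / lam j)) = 0 &
    B *m (lsubmx Y *m be) = 0].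
Proof.
move=> dX dY sol lam0 mu0 be0.
have uX : lsubmx X \in unitmx by rewrite unitmxE unitfE.
have uY : lsubmx Y \in unitmx by rewrite unitmxE unitfE.
have [B0 rB0 B0b] := rank3_kernel be0.
pose L := diag_mx (\row_j lam j).
have uL : L \in unitmx.
  rewrite unitmxE unitfE det_diag; apply/prodf_neq0 => j _; by rewrite mxE.
pose kap (i : 'I_(4 + 3)) := match split i with
  | inl j => lam j
  | inr k => mu k * \det (lsubmx Y) / \det (lsubmx X) end.
exists (B0 *m L *m invmx (lsubmx X)), (B0 *m invmx (lsubmx Y)), kap.
have rankU (C : 'M[K]_(3, 4)) U : U \in unitmx -> \rank (C *m U) = \rank C.
  by move=> uU; rewrite mxrankMfree // row_free_unit.
have colX Z k : \det (lsubmx Z) != 0 -> invmx (lsubmx Z) *m col (rshift 4 k) Z =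
    (\det (lsubmx Z))^-1 *: col k (affine_coords Z).
  move=> dZ; have uZ : lsubmx Z \in unitmx by rewrite unitmxE unitfE.
  apply: (canLR (mulKmx uZ)); rewrite -scalemxAr.
  by rewrite affine_coords_col scalerA mulVf // scale1r.
have colB (Z : 'M[K]_(4, 4 + 3)) j : \det (lsubmx Z) != 0 ->
    invmx (lsubmx Z) *m col (lshift 3 j) Z = col j 1%:M.
  move=> dZ; have uZ : lsubmx Z \in unitmx by rewrite unitmxE unitfE.
  by apply: (canLR (mulKmx uZ)); rewrite base_col.
split.
- by rewrite !rankU ?unitmx_inv.
- move=> i; rewrite /kap; case: (split i) => [j|k] //.
  by rewrite !mulf_neq0 ?invr_neq0.
- move=> i; rewrite -(splitK i) /kap unsplitK -!mulmxA.
  case: (split i) => [j|k] /=.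
    rewrite !colB // scalemxAr; congr (_ *m _).
    rewrite mul_diag_mx; apply/colP => l; rewrite !mxE.
    by case: eqP => [->|]; rewrite ?mulr0.
  have E : L *m col k (affine_coords X) =
      mu k *: col k (affine_coords Y) - p k *: be.
    rewrite mul_diag_mx.
    move: (affine_coords X) (affine_coords Y) sol => x y sol.
    apply/colP => j; rewrite !mxE.
    by rewrite [mu k * _]mulrC sol [p k * _]mulrC addrK.
  rewrite !colX // -!scalemxAr E mulmxBr -!scalemxAr B0b scaler0 subr0 !scalerA.
  by congr (_ *: _); field; apply/andP.
- rewrite -mulmxA mulKmx // -mulmxA mul_diag_mx -[RHS]B0b; congr (_ *m _).
  by apply/colP => j; rewrite !mxE mulrC divfK.
- by rewrite -mulmxA mulKmx.
Qed.

End Cameras.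

(** * Centers and secant lines *)

Section Secants.
Variable K : fieldType.
Implicit Types (X Y : 'M[K]_(4, 4 + 3)) (A B : 'M[K]_(3, 4)).
Implicit Types kap : 'I_(4 + 3) -> K.

(** Quantifying over the orderings of the points makes the condition on the
    first two points available for any two of them. *)
Definition cross_ratios_differ X Y : Prop := forall s : 'S_(4 + 3),
  [/\ \det (lsubmx (col_perm s X)) != 0, \det (lsubmx (col_perm s Y)) != 0 &
      cross_ratio_neq (affine_coords (col_perm s X))
                      (affine_coords (col_perm s Y))].

Lemma cross_ratios_differ_sym X Y : cross_ratios_differ X Y -> cross_ratios_differ Y X.
Proof.
move=> cr s; have [dX dY neq] := cr s; split=> //.
by move: neq; rewrite /cross_ratio_neq eq_sym mulrC [_ * _ * (_ * _)]mulrC.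
Qed.

Lemma same_images_perm X Y A B kap s : same_images X Y A B kap ->
  same_images (col_perm s X) (col_perm s Y) A B (kap \o s).
Proof.
move=> im i; have E Z : col i (col_perm s Z) = col (s i) Z :> 'cV[K]_4.
  by apply/colP => j; rewrite !mxE.
by rewrite !E im.
Qed.

Lemma same_images_sym X Y A B kap : (forall i, kap i != 0) ->
  same_images X Y A B kap -> same_images Y X B A (fun i => (kap i)^-1).
Proof. by move=> kap0 im i; rewrite im scalerA mulVf // scale1r. Qed.

Lemma perm_pair (T : finType) (a b i j : T) : a != b -> i != j ->
  exists s : {perm T}, s a = i /\ s b = j.
Proof.
move=> ab ij; pose j' := tperm a i j.
(* After [a] and [i] are exchanged, [b] has to be sent to [j']. *)
have j'a : j' != a by rewrite -(tpermR a i) (inj_eq perm_inj) eq_sym.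
exists (tperm b j' * tperm a i)%g; rewrite !permM; split.
  by rewrite (@tpermD _ b j' a) ?tpermL // eq_sym.
by rewrite tpermL tpermK.
Qed.

(** Reordered so that the two points come first, the center has the last two of
    its four coordinates equal to zero, against [cross_ratio_base]. *)
Lemma center_off_secants X Y A B kap (b : 'cV[K]_4) : cross_ratios_differ X Y ->
  \rank B = 3%N -> (forall i, kap i != 0) -> same_images X Y A B kap ->
  b != 0 -> B *m b = 0 ->
  forall i j s t, i != j -> b <> s *: col i Y + t *: col j Y.
Proof.
move=> cr rB kap0 im b0 Bb i j s t ij bE.
pose e0 : 'I_4 := inord 0; pose e1 : 'I_4 := inord 1.
have [|sg [sg0 sg1]] := @perm_pair _ (lshift 3 e0) (lshift 3 e1) i j _ ij.
  by rewrite (inj_eq (@lshift_inj _ _)) -val_eqE /= !inordK.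
have [dX dY neq] := cr sg; set X' := col_perm sg X in dX neq.
set Y' := col_perm sg Y in dY neq.
pose be : 'cV[K]_4 := s *: col e0 1%:M + t *: col e1 1%:M.
have QE l : lsubmx Y' *m col l 1%:M = col (sg (lshift 3 l)) Y.
  by rewrite base_col; apply/colP => m; rewrite !mxE.
have Qbe : lsubmx Y' *m be = b.
  by rewrite mulmxDr -!scalemxAr !QE sg0 sg1 -bE.
have be0 : be != 0 by apply: contraNneq b0 => e; rewrite -Qbe e mulmx0.
have [||mu [p [mu0 sol]]] := solves_of_cameras dX dY rB _
    (same_images_perm sg im) be0 _.
- by move=> l; apply: kap0.
- by rewrite Qbe.
have z l : l != e0 -> l != e1 -> be l 0 = 0.
  by move=> l0 l1; rewrite !mxE (negbTE l0) (negbTE l1) !mulr0 addr0.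
apply: (cross_ratio_base neq sol) => //.
- by move=> l; apply: kap0.
- by apply: z; rewrite -val_eqE /= !inordK.
- by apply: z; rewrite -val_eqE /= !inordK.
Qed.

Lemma other_pair (i j : 'I_4) : i != j ->
  exists k l, k != l /\ forall m, m != i -> m != j -> m = k \/ m = l.
Proof.
move=> ij; have : #|~: [set i; j]| == 2.
  by rewrite cardsCs finset.setCK card_ord cards2 ij.
case/cards2P => k [l [kl E]]; exists k, l; split=> // m mi mj.
have : m \in ~: [set i; j] by rewrite !inE negb_or mi.
by rewrite E !inE => /orP[] /eqP->; [left|right].
Qed.

Lemma off_secants_coords Y (be : 'cV[K]_4) : \det (lsubmx Y) != 0 ->
  (forall i j s t, i != j -> lsubmx Y *m be <> s *: col i Y + t *: col j Y) ->
  off_secants (affine_coords Y) (fun j => be j 0).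
Proof.
move=> dY off; split=> [i j ij bi bj | k i c].
  have [k [l [kl E]]] := other_pair ij.
  apply: (off (lshift 3 k) (lshift 3 l) (be k 0) (be l 0)).
    by rewrite (inj_eq (@lshift_inj _ _)).
  rewrite -!base_col !scalemxAr -mulmxDr; congr (_ *m _).
  apply/colP => m; rewrite !mxE.
  have [-> | mi] := eqVneq m i.
    rewrite bi; case: (eqVneq i k) => [<- | _]; case: (eqVneq i l) => [<- | _];
      by rewrite ?bi !(mul0r, mulr0, addr0).
  have [-> | mj] := eqVneq m j.
    rewrite bj; case: (eqVneq j k) => [<- | _]; case: (eqVneq j l) => [<- | _];
      by rewrite ?bj !(mul0r, mulr0, addr0).
  have [-> | ->] := E m mi mj.
    by rewrite eqxx (negbTE kl) mulr1 mulr0 addr0.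
  by rewrite eqxx eq_sym (negbTE kl) mulr1 mulr0 add0r.
have [j /andP[ji jy] | /= no] :=
    pickP (fun j => (j != i) && (be j 0 != c * affine_coords Y j k)).
  by exists j => //; apply/eqP.
have E j : j != i -> be j 0 = c * affine_coords Y j k.
  by move=> ji; have := no j; rewrite ji => /negbFE/eqP.
case: (off (rshift 4 k) (lshift 3 i) (c * \det (lsubmx Y))
            (be i 0 - c * affine_coords Y i k)).
  by rewrite eq_sym eq_lrshift.
rewrite -base_col -scalerA -affine_coords_col !scalemxAr -mulmxDr.
congr (_ *m _); move: (affine_coords Y) E => y E; apply/colP => j; rewrite !mxE.
have [-> | ji] := eqVneq j i; first by rewrite mulr1 addrC subrK.
by rewrite mulr0 addr0 E.
Qed.

End Secants.

(** * The three pairs of centers, in coordinates *)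

Section Centers.
Variable K : closedFieldType.
Implicit Types (X Y : 'M[K]_(4, 4 + 3)).

Definition compatible X Y (a b : 'cV[K]_4) : Prop :=
  exists A B kap, [/\ \rank A = 3%N /\ \rank B = 3%N, forall i, kap i != 0,
    same_images X Y A B kap, A *m a = 0 & B *m b = 0].

(** The passage from solutions to centers: [be] determines the second center,
    and the first one is the image of [be_j / lam_j], the kernel of a camera
    being a line. *)
Lemma three_centers X Y : cross_ratios_differ X Y ->
  regular (affine_coords X) (affine_coords Y) ->
  exists a b : 'I_3 -> 'cV[K]_4,
  [/\ forall r, [/\ a r != 0, b r != 0 & compatible X Y (a r) (b r)],
      forall a' b', a' != 0 -> b' != 0 -> compatible X Y a' b' ->
        exists r s t, [/\ s != 0, t != 0, a' = s *: a r & b' = t *: b r] &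
      forall r s c d, c != 0 -> d != 0 -> a s = c *: a r -> b s = d *: b r ->
        r = s].
Proof.
move=> cr reg; have [] := cr 1%g; rewrite !col_perm1 => dX dY neq.
have uX : lsubmx X \in unitmx by rewrite unitmxE unitfE.
have uY : lsubmx Y \in unitmx by rewrite unitmxE unitfE.
have mul_neq0 (P : 'M[K]_4) (v : 'cV_4) : P \in unitmx -> v != 0 -> P *m v != 0.
  by move=> uP; apply: contraNneq => e; rewrite -(mulKmx uP v) e mulmx0.
have [lam [be [mu [p [sols all_sol sol_inj]]]]] := three_solutions reg.
pose bc r : 'cV[K]_4 := \col_j be r j.
pose ac r : 'cV[K]_4 := \col_j (be r j / lam r j).
have nz r : bc r != 0 /\ ac r != 0.
  have [sol lam0 mu0] := sols r.
  have [j bj] : exists j, be r j != 0.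
    have [b2|b2] := eqVneq (be r (inord 2)) 0; last by exists (inord 2).
    by exists (inord 3); apply/eqP/(cross_ratio_base neq sol).
  split; apply/eqP => /colP/(_ j)/eqP; rewrite !mxE ?(negbTE bj) //.
  by rewrite mulf_eq0 invr_eq0 (negbTE bj) (negbTE (lam0 j)).
have comp r : compatible X Y (lsubmx X *m ac r) (lsubmx Y *m bc r).
  have [sol lam0 mu0] := sols r; have [bc0 _] := nz r.
  have sol' : solves (affine_coords X) (affine_coords Y) (lam r)
      (fun j => bc r j 0) (mu r) (p r).
    by move=> j k; rewrite [bc r j 0]mxE; apply: sol.
  have [A [B [kap [rAB kap0 im Aa Bb]]]] :=
    cameras_of_solves dX dY sol' lam0 mu0 bc0.
  exists A, B, kap; split=> //; rewrite -[RHS]Aa; congr (_ *m (_ *m _)).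
  by apply/colP => j; rewrite !mxE.
exists (fun r => lsubmx X *m ac r), (fun r => lsubmx Y *m bc r); split.
- by move=> r; have [b0 a0] := nz r; split; rewrite ?mul_neq0.
- move=> a' b' a0 b0 [A [B [kap [[rA rB] kap0 im Aa Bb]]]].
  pose be' := invmx (lsubmx Y) *m b'.
  have be'E : lsubmx Y *m be' = b' by rewrite mulKVmx.
  have be'0 : be' != 0 by rewrite mul_neq0 ?unitmx_inv.
  have [|mu' [p' [mu'0 sol']]] := solves_of_cameras dX dY rB kap0 im be'0.
    by rewrite be'E.
  have [r [s [t [s0 t0 lamE beE]]]] :=
    all_sol _ _ _ _ sol' (fun j => kap0 _) mu'0.
  have be'r : be' = t *: bc r by apply/colP => j; rewrite beE !mxE.
  have Aac : A *m (lsubmx X *m ac r) = 0.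
    rewrite (same_images_base _ im).
    have -> : \col_j (kap (lshift 3 j) * ac r j 0) = (s / t) *: be'.
      apply/colP => j; have [_ lam0 _] := sols r.
      rewrite [LHS]mxE lamE [RHS]mxE beE mxE; field.
      by rewrite t0 lam0.
    by rewrite -!scalemxAr be'E Bb scaler0.
  have [c aE] := ker_line rA (mul_neq0 _ _ uX (nz r).2) Aac Aa.
  exists r, c, t; split=> //; last by rewrite scalemxAr -be'r be'E.
  by apply: contraNneq a0 => c0; rewrite aE c0 scale0r.
- move=> r s c d c0 d0 aE bE; have [b0 a0] := nz r.
  have [A [B [kap [[rA rB] kap0 im Aa Bb]]]] := comp r.
  have off := center_off_secants cr rB kap0 im (mul_neq0 _ _ uY b0) Bb.
  have cancel_unit (P : 'M[K]_4) (u v : 'cV_4) e : P \in unitmx ->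
      P *m u = e *: (P *m v) -> u = e *: v.
    by move=> uP E; rewrite -(mulKmx uP u) E -scalemxAr mulKmx.
  apply: (sol_inj r s d c) => //.
  + have [o1 o2] := off_secants_coords dY off; split=> [i j ij | k i e].
      by have := o1 i j ij; rewrite !mxE.
    by have [j ji jn] := o2 k i e; exists j => //; move: jn; rewrite mxE.
  + by move=> j; have /colP/(_ j) := cancel_unit _ _ _ _ uY bE; rewrite !mxE.
  + by move=> j; have /colP/(_ j) := cancel_unit _ _ _ _ uX aE; rewrite !mxE.
Qed.

End Centers.

(** * Polynomial functions and generic matrices *)

Section MPolyZero.
Variable K : closedFieldType.

Lemma poly_eq0_horner (q : {poly K}) : (forall t, q.[t] = 0) -> q = 0.
Proof.
move=> q0; apply/eqP/negPn/negP => /closed_nonrootP[t].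
by rewrite /root q0 eqxx.
Qed.

(** This makes [muni] injective. *)
Lemma coef_muni n (f : {mpoly K[n.+1]}) (m : 'X_{1..n.+1}) :
  (muni f)`_(m ord_max) @_[multinom m (widen_ord (leqnSn n) i) | i < n] = f@_m.
Proof.
rewrite muniE coef_sum raddf_sum /=.
rewrite (eq_bigr (fun m' => f@_m' * (m' == m)%:R)) => [|m' _]; last first.
  rewrite coefZ coefXn; case: (eqVneq m' m) => [->|].
    by rewrite eqxx !mulr1 mcoeffZ mcoeffX eqxx mulr1.
  apply: contraNeq; rewrite mulr0.
  case: (m ord_max =P m' ord_max) => [mE|_];
    last by rewrite mulr0 mcoeff0 eqxx.
  rewrite mulr1 mcoeffZ mcoeffX.
  case: ([multinom _ | _ < _] =P _) => [mE'|_]; last by rewrite mulr0 eqxx.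
  move=> _; apply/eqP/mnmP => i.
  have [i_lt|i_ge] := ltnP i n.
    have := congr1 (fun m : 'X_{1..n} => m (Ordinal i_lt)) mE'; rewrite !mnmE.
    have -> : widen_ord (leqnSn n) (Ordinal i_lt) = i by exact: val_inj.
    by move->.
  have -> : i = ord_max; last by rewrite mE.
  by apply: val_inj; apply/eqP; rewrite eqn_leq i_ge -ltnS ltn_ord.
have [mf|mf] := boolP (m \in msupp f).
  rewrite (bigD1_seq m) ?msupp_uniq //= eqxx mulr1.
  rewrite big1 ?addr0 // => m' /negbTE->.
  by rewrite mulr0.
rewrite (memN_msupp_eq0 mf) big_seq big1 // => m' m'f.
by case: eqP m'f => [->|]; rewrite ?mulr0 ?(negbTE mf).
Qed.

Lemma meval_muni n (f : {mpoly K[n.+1]}) (x : 'I_n.+1 -> K) :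
  f.@[x] = (map_poly (meval (fun i => x (widen_ord (leqnSn n) i)))
              (muni f)).[x ord_max].
Proof.
rewrite muniE rmorph_sum horner_sum mevalE; apply: eq_bigr => m _ /=.
rewrite map_polyZ map_polyXn /= hornerZ hornerXn mevalZ mevalX.
rewrite -mulrA big_ord_recr /=.
by congr (_ * (_ * _)); apply: eq_bigr => i _; rewrite mnmE.
Qed.

(** Induction on the number of variables: at fixed values of the others, the
    polynomial in the last variable vanishes at infinitely many points. *)
Lemma mpoly_eq0_meval n (f : {mpoly K[n]}) : (forall x, f.@[x] = 0) -> f = 0.
Proof.
elim: n f => [|n IHn] f f0.
  have := f0 (fun=> 0); rewrite [f]nvar0_mpolyC mevalC => ->; exact: mpolyC0.
have muni0 : muni f = 0.
  apply/polyP => i; rewrite coef0; apply: IHn => x.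
  pose q := map_poly (meval x) (muni f).
  have -> : ((muni f)`_i).@[x] = q`_i by rewrite coef_map.
  rewrite [q]poly_eq0_horner ?coef0 // => t.
  pose x' i := oapp x t (unlift ord_max i).
  have := f0 x'; rewrite meval_muni /x' unlift_none /= => <-; congr (_.[_]).
  rewrite /q; apply: eq_map_poly => g; apply: meval_eq => j.
  have -> : widen_ord (leqnSn n) j = lift ord_max j.
    by apply: val_inj; rewrite /= /bump leqNgt ltn_ord.
  by rewrite liftK.
by apply/mpolyP => m; rewrite -coef_muni muni0 coef0 !mcoeff0.
Qed.

Lemma mpoly_neq0_meval n (f : {mpoly K[n]}) : f != 0 -> exists x, f.@[x] != 0.
Proof.
move=> f0; apply: contrapT => no_x; case/eqP: f0; apply: mpoly_eq0_meval => x.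
by apply/eqP/negPn/negP => fx; apply: no_x; exists x.
Qed.

End MPolyZero.

Section Generic.
Variables (K : closedFieldType) (n k : nat).
Local Notation mat := 'M[K]_(n, k).
Local Notation coords M := (fun l => mxvec M 0 l).

Definition polyfun (phi : mat -> K) : Prop :=
  exists f : {mpoly K[n * k]}, forall M, phi M = f.@[coords M].

Lemma polyfun_cst c : polyfun (fun=> c).
Proof. by exists c%:MP => M; rewrite mevalC. Qed.

Lemma polyfun_coord i j : polyfun (fun M => M i j).
Proof. by exists 'X_(mxvec_index i j) => M; rewrite mevalXU mxvecE. Qed.

Lemma polyfunD phi psi :
  polyfun phi -> polyfun psi -> polyfun (fun M => phi M + psi M).
Proof. by move=> [f fE] [g gE]; exists (f + g) => M; rewrite mevalD fE gE. Qed.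

Lemma polyfunN phi : polyfun phi -> polyfun (fun M => - phi M).
Proof. by move=> [f fE]; exists (- f) => M; rewrite mevalN fE. Qed.

Lemma polyfunM phi psi :
  polyfun phi -> polyfun psi -> polyfun (fun M => phi M * psi M).
Proof. by move=> [f fE] [g gE]; exists (f * g) => M; rewrite mevalM fE gE. Qed.

Lemma polyfunMn phi c : polyfun phi -> polyfun (fun M => phi M *+ c).
Proof. by move=> [f fE]; exists (f *+ c) => M; rewrite mevalMn fE. Qed.

Lemma polyfunX phi c : polyfun phi -> polyfun (fun M => phi M ^+ c).
Proof. by move=> [f fE]; exists (f ^+ c) => M; rewrite rmorphXn fE. Qed.

Lemma polyfun_sum (I : finType) (F : I -> mat -> K) :
  (forall i, polyfun (F i)) -> polyfun (fun M => \sum_i F i M).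
Proof.
move=> /fin_all_exists[f fE]; exists (\sum_i f i) => M.
by rewrite raddf_sum; apply: eq_bigr => i _; apply: fE.
Qed.

Lemma polyfun_prod (I : finType) (F : I -> mat -> K) :
  (forall i, polyfun (F i)) -> polyfun (fun M => \prod_i F i M).
Proof.
move=> /fin_all_exists[f fE]; exists (\prod_i f i) => M.
by rewrite rmorph_prod; apply: eq_bigr => i _; apply: fE.
Qed.

Lemma eq_polyfun phi psi : phi =1 psi -> polyfun phi -> polyfun psi.
Proof. by move=> e [f fE]; exists f => M; rewrite -e. Qed.

Lemma polyfun_det r (F : mat -> 'M[K]_r) :
  (forall i j, polyfun (fun M => F M i j)) -> polyfun (fun M => \det (F M)).
Proof.
move=> FP; apply: polyfun_sum => s; apply: polyfunM; first exact: polyfun_cst.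
by apply: polyfun_prod => i; apply: FP.
Qed.

Lemma polyfun_adj r (F : mat -> 'M[K]_r) :
  (forall i j, polyfun (fun M => F M i j)) ->
  forall i j, polyfun (fun M => (\adj (F M)) i j).
Proof.
move=> FP i j; apply: eq_polyfun (fun M => esym (mxE _ _ _ _)) _.
apply: polyfunM; first exact: polyfun_cst.
apply: polyfun_det => i' j'.
apply: eq_polyfun (FP (lift j i') (lift i j')) => M; by rewrite !mxE.
Qed.

Lemma polyfun_mulmx r s t (F : mat -> 'M[K]_(r, s)) (G : mat -> 'M[K]_(s, t)) :
  (forall i j, polyfun (fun M => F M i j)) ->
  (forall i j, polyfun (fun M => G M i j)) ->
  forall i j, polyfun (fun M => (F M *m G M) i j).
Proof.
move=> FP GP i j; apply: eq_polyfun (fun M => esym (mxE _ _ _ _)) _.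
by apply: polyfun_sum => l; apply: polyfunM.
Qed.

(** The polynomial is not asked to be multihomogeneous, so this is a property
    of coordinate matrices rather than of the points they represent; see
    [zariski_open_nonzeros] for the passage to points. *)
Definition generically (P : mat -> Prop) : Prop :=
  exists2 f : {mpoly K[n * k]}, f != 0 & forall M, f.@[coords M] != 0 -> P M.

Lemma generically_neq0 phi :
  polyfun phi -> (exists M, phi M != 0) -> generically (fun M => phi M != 0).
Proof.
move=> [f fE] [M M0]; exists f => [|N]; last by rewrite fE.
by apply: contraNneq M0 => f0; rewrite fE f0 meval0.
Qed.

Lemma generically_sub (P Q : mat -> Prop) :
  (forall M, P M -> Q M) -> generically P -> generically Q.
Proof. by move=> PQ [f f0 fP]; exists f => // M /fP/PQ. Qed.

Lemma generically_and (P Q : mat -> Prop) :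
  generically P -> generically Q -> generically (fun M => P M /\ Q M).
Proof.
move=> [f f0 fP] [g g0 gQ]; exists (f * g); first by rewrite mulf_neq0.
by move=> M; rewrite mevalM mulf_eq0 negb_or => /andP[/fP ? /gQ ?].
Qed.

Lemma generically_forall (I : finType) (P : I -> mat -> Prop) :
  (forall i, generically (P i)) -> generically (fun M => forall i, P i M).
Proof.
move=> /fin_all_exists2[f f0 fP]; exists (\prod_i f i).
  by apply/prodf_neq0 => i _; apply: f0.
move=> M M0 i; apply: fP; apply: contraNneq M0 => fi0.
by rewrite rmorph_prod; apply/prodf_eq0; exists i => //=; rewrite fi0.
Qed.

Lemma generically_exists P : generically P -> exists M, P M.
Proof.
move=> [f f0 fP]; have [x fx] := mpoly_neq0_meval f0.
exists (vec_mx (\row_l x l)); apply: fP; rewrite vec_mxK.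
by under meval_eq do rewrite mxE.
Qed.

End Generic.

(** * Genericity of the conditions on the configurations *)

Section Genericity.
Variable K : closedFieldType.
Local Notation mat := 'M[K]_(4, (4 + 3) + (4 + 3)).
Implicit Types (x y : 'M[K]_(4, 3)).

Definition polymx r s (F : mat -> 'M[K]_(r, s)) : Prop :=
  forall i j, polyfun (fun M => F M i j).

Definition polyfun2 (phi : 'M[K]_(4, 3) -> 'M[K]_(4, 3) -> K) : Prop :=
  forall F G : mat -> 'M[K]_(4, 3), polymx F -> polymx G ->
    polyfun (fun M => phi (F M) (G M)).

Definition lcoords (s : 'S_(4 + 3)) (M : mat) :=
  affine_coords (col_perm s (lsubmx M)).
Definition rcoords (s : 'S_(4 + 3)) (M : mat) :=
  affine_coords (col_perm s (rsubmx M)).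

Lemma polymx_affine s F : @polymx 4 (4 + 3) F ->
  polymx (fun M => affine_coords (col_perm s (F M))).
Proof.
move=> FP; apply: polyfun_mulmx => i j.
  apply: polyfun_adj => i' j'.
  by apply: eq_polyfun (FP i' (s (lshift 3 j'))) => M; rewrite !mxE.
by apply: eq_polyfun (FP i (s (rshift 4 j))) => M; rewrite !mxE.
Qed.

Lemma polymx_l : polymx (fun M : mat => lsubmx M).
Proof.
move=> i j; apply: eq_polyfun (polyfun_coord K i (lshift _ j)) => M.
by rewrite mxE.
Qed.

Lemma polymx_r : polymx (fun M : mat => rsubmx M).
Proof.
move=> i j; apply: eq_polyfun (polyfun_coord K i (rshift _ j)) => M.
by rewrite mxE.
Qed.

Lemma affine_coords1 x : affine_coords (row_mx 1%:M x) = x.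
Proof. by rewrite /affine_coords row_mxKl row_mxKr adj1 mul1mx. Qed.

(** A pair of configurations that has prescribed affine coordinates once its
    points are reordered by [s]. *)
Definition framed (s : 'S_(4 + 3)) x y : mat :=
  row_mx (col_perm s^-1%g (row_mx 1%:M x)) (col_perm s^-1%g (row_mx 1%:M y)).

Lemma framedK s x y :
  lcoords s (framed s x y) = x /\ rcoords s (framed s x y) = y.
Proof.
rewrite /lcoords /rcoords /framed row_mxKl row_mxKr -!col_permM mulgV.
by rewrite !col_perm1 !affine_coords1.
Qed.

Lemma generically2 s phi : polyfun2 phi -> (exists x y, phi x y != 0) ->
  generically (fun M => phi (lcoords s M) (rcoords s M) != 0).
Proof.
move=> phiP [x [y xy]]; apply: generically_neq0.
  by apply: phiP; apply: polymx_affine; [exact: polymx_l | exact: polymx_r].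
by exists (framed s x y); have [-> ->] := framedK s x y.
Qed.

Lemma generically_base s : generically (fun M : mat =>
  \det (lsubmx (col_perm s (lsubmx M))) != 0 /\
  \det (lsubmx (col_perm s (rsubmx M))) != 0).
Proof.
have H (F : mat -> 'M[K]_(4, 4 + 3)) : polymx F ->
    polyfun (fun M => \det (lsubmx (col_perm s (F M)))).
  move=> FP; apply: polyfun_det => i j.
  by apply: eq_polyfun (FP i (s (lshift 3 j))) => M; rewrite !mxE.
apply: generically_and; apply: generically_neq0; try apply: H;
  [exact: polymx_l | | exact: polymx_r |]; exists (framed s 0 0).
  rewrite /framed row_mxKl -col_permM mulgV col_perm1.
  by rewrite row_mxKl det1 oner_neq0.
by rewrite /framed row_mxKr -col_permM mulgV col_perm1 row_mxKl det1 oner_neq0.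
Qed.

Lemma polymx_minor F G k l : @polymx 4 3 F -> @polymx 4 3 G ->
  polymx (fun M => minor_mx (F M) (G M) k l).
Proof.
move=> FP GP j i.
have vP m : polyfun (fun M => vcol (F M) (G M) m j 0).
  apply: eq_polyfun (polyfunM (FP j m) (GP j (ordS m))) => M; by rewrite mxE.
have wP m : polyfun (fun M => wcol (F M) (G M) m j 0).
  apply: eq_polyfun (polyfunN (polyfunM (FP j m) (GP j (ordS (ordS m))))) => M.
  by rewrite !mxE.
by case: i => [[|[|[|[|//]]]] lti];
  [apply: eq_polyfun (vP (ordS k)) | apply: eq_polyfun (vP (ordS (ordS k))) |
   apply: eq_polyfun (wP (ordS l)) |
   apply: eq_polyfun (wP (ordS (ordS l)))] => M;
  rewrite [RHS]mxE.
Qed.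

Lemma polyfun2_minor k l : polyfun2 (fun x y => \det (minor_mx x y k l)).
Proof. by move=> F G FP GP; apply: polyfun_det; apply: polymx_minor. Qed.

Lemma polyfun2_swap phi : polyfun2 phi -> polyfun2 (fun x y => phi y x).
Proof. by move=> phiP F G FP GP; apply: phiP. Qed.

Lemma polyfun2_align j : polyfun2 (fun x y => align_det x y j).
Proof.
move=> F G FP GP; apply: polyfun_det => i l.
apply: eq_polyfun (fun M => esym (mxE _ _ _ _)) _.
apply: polyfunM => //.
by apply: polyfunD; [|apply: polyfunN]; apply: polyfunM.
Qed.

Lemma polyfun2_disc : polyfun2 (fun x y => pencil_disc x y).
Proof.
move=> F G FP GP.
have lP i : polyfun (fun M => cubic_lin (F M) (G M) i).
  apply: polyfunN; apply: polyfun_mulmx; last first.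
    move=> j k; rewrite (ord1 k).
    apply: eq_polyfun (polyfunM (FP j ord0) (GP j (ordS ord0))) => M.
    by rewrite mxE.
  by apply: polyfun_adj; apply: polymx_minor.
have cP i : polyfun (fun M => cubic_cst (F M) (G M) i).
  apply: polyfunN; apply: polyfun_mulmx; last first.
    move=> j k; rewrite (ord1 k).
    have := polyfunN (polyfunM (FP j ord0) (GP j (ordS (ordS ord0)))).
    by apply: eq_polyfun => M; rewrite !mxE.
  by apply: polyfun_adj; apply: polymx_minor.
rewrite /pencil_disc /cubic_disc.
by do ![exact: lP | exact: cP | apply: polyfunD | apply: polyfunN
  | apply: polyfunMn | apply: polyfunX | apply: polyfunM].
Qed.

Lemma ordS_neq (m : 'I_3) : (ordS m == m) = false.
Proof. by apply/eqP => /(congr1 val); case: m => [[|[|[|//]]] ?]. Qed.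

(** If [x j] and [y j] are the basis vectors of indices [m] and [m + 1], then
    row [j] of the system is the basis vector of the unknown [v m]; with
    indices [m] and [m + 2] it is minus that of [w m]. So any four columns can
    be made a diagonal matrix. *)
Lemma minor_witness k l : exists x y, \det (minor_mx x y k l) != 0.
Proof.
pose xi := [:: ordS k; ordS (ordS k); ordS l; ordS (ordS l)].
pose eta := [:: ordS (ordS k); ordS (ordS (ordS k));
                ordS (ordS (ordS l)); ordS (ordS (ordS (ordS l)))].
pose unit_rows (c : seq 'I_3) : 'M[K]_(4, 3) :=
  \matrix_(j, m) (m == nth ord0 c j)%:R.
exists (unit_rows xi), (unit_rows eta).
pose e (b : bool) : K := b%:R.
have vv m r : e (m == r) * e (ordS m == ordS r :> 'I_3) = e (m == r).
  by rewrite (inj_eq (@ordS_inj _)) -natrM mulnb andbb.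
have ww m r :
    e (m == r) * e (ordS (ordS m) == ordS (ordS r) :> 'I_3) = e (m == r).
  by rewrite !(inj_eq (@ordS_inj _)) -natrM mulnb andbb.
have vw m r : e (m == r) * e (ordS m == ordS (ordS r) :> 'I_3) = 0.
  by case: eqP => [->|_]; rewrite ?mul0r // eq_sym ordS_neq mulr0.
have wv m r : e (m == r) * e (ordS (ordS m) == ordS r :> 'I_3) = 0.
  by case: eqP => [->|_]; rewrite ?mul0r // ordS_neq mulr0.
have -> : minor_mx (unit_rows xi) (unit_rows eta) k l =
    diag_mx (\row_j [:: 1; 1; -1; -1]`_j) :> 'M[K]_4.
  apply/matrixP => i j; rewrite mxE.
  case: i => [[|[|[|[|//]]]] lti]; case: j => [[|[|[|[|//]]]] ltj];
  by rewrite !mxE /= -!/(e _) ?(vv, ww, vw, wv) /e ?eqxx ?ordS_neq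
    ?[ordS _ == ordS (ordS _)]eq_sym ?ordS_neq ?oppr0.
rewrite det_diag; apply/prodf_neq0 => j _; rewrite mxE.
by case: j => [[|[|[|[|//]]]] ltj] /=; rewrite ?oppr_eq0 oner_neq0.
Qed.

(** The rows other than [j] are basis vectors, chosen so that the matrix in
    [align_det] is the identity. *)
Lemma align_witness j : exists x y, align_det x y j != 0.
Proof.
exists (\matrix_(a, c)
  if unlift j a is Some i then (c == ordS (ordS i))%:R else 1).
exists (\matrix_(a, c) if unlift j a is Some i then (c == i)%:R else 0).
rewrite /align_det (_ : \matrix_(_, _) _ = 1%:M) ?det1 ?oner_neq0 //.
apply/matrixP => i l; rewrite !mxE /cross !mxE unlift_none liftK.
rewrite [i == l]eq_sym; case: (l =P i) => [->|_]; last by rewrite mul0r.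
by rewrite eqxx [ordS i == _]eq_sym ordS_neq !mul1r subr0.
Qed.

Definition rows3 (s : seq (seq K)) : 'M[K]_(4, 3) :=
  \matrix_(i, j) (nth [::] s i)`_j.

(** The minor is the identity and the cubic is [s - s^2], without a term of
    degree three: as a binary form it has the distinct roots 0, 1 and
    infinity. *)
Lemma disc_witness : exists x y, pencil_disc x y != 0.
Proof.
pose x := rows3 [:: [:: 1; 1; 0]; [:: 1; 0; 1]; [:: 0; -1; 0]; [:: 0; 0; -1]].
pose y := rows3 [:: [:: 0; 1; 1]; [:: 1; 0; 1]; [:: 1; 0; 0]; [:: 0; 1; 0]].
exists x, y; have M1 : minor_mx x y ord0 ord0 = 1%:M.
  apply/matrixP => i j; rewrite !mxE.
  by case: i => [[|[|[|[|//]]]] lti]; case: j => [[|[|[|[|//]]]] ltj];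
    rewrite ?mxE /= ?(mul0r, mulr0, mulr1, oppr0, mulrN, mulNr, opprK).
rewrite /pencil_disc /cubic_cst /cubic_lin M1 adj1 !mul1mx !mxE !inordK //=.
rewrite /cubic_disc (_ : _ + _ = 1) ?oner_neq0 //; ring.
Qed.

Lemma cross_witness : exists x y : 'M[K]_(4, 3), cross_ratio_neq x y.
Proof.
exists (rows3 [:: [::]; [::]; [:: 1; 0; 0]; [:: 0; 1; 0]]).
exists (rows3 [:: [::]; [::]; [:: 0; 1; 0]; [:: 1; 0; 0]]).
by rewrite /cross_ratio_neq !mxE !inordK //= !mulr1 !mul0r oner_neq0.
Qed.

Lemma generically_regular : generically (fun M : mat =>
  cross_ratios_differ (lsubmx M) (rsubmx M) /\
  regular (affine_coords (lsubmx M)) (affine_coords (rsubmx M))).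
Proof.
apply: generically_and.
  apply: generically_forall => s.
  pose phi x y := x (inord 2) ord0 * x (inord 3) (ordS ord0) *
    (y (inord 3) ord0 * y (inord 2) (ordS ord0)) -
    x (inord 3) ord0 * x (inord 2) (ordS ord0) *
    (y (inord 2) ord0 * y (inord 3) (ordS ord0)) : K.
  have cr : generically (fun M => cross_ratio_neq (lcoords s M) (rcoords s M)).
    apply: (@generically_sub _ _ _
      (fun M => phi (lcoords s M) (rcoords s M) != 0)).
      by move=> M; rewrite subr_eq0.
    apply: generically2.
      move=> F G FP GP.
      by apply: polyfunD; [|apply: polyfunN]; do !apply: polyfunM.
    by have [x [y xy]] := cross_witness; exists x, y; rewrite subr_eq0.
  by apply: generically_sub (generically_and (generically_base s) cr) => M [[]].
have E phi : polyfun2 phi -> (exists x y, phi x y != 0) ->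
    generically (fun M =>
      phi (affine_coords (lsubmx M)) (affine_coords (rsubmx M)) != 0).
  move=> phiP phi0; apply: generically_sub (generically2 1%g phiP phi0) => M.
  by rewrite /lcoords /rcoords !col_perm1.
have mins := generically_forall (fun k => generically_forall (fun l =>
  E _ (polyfun2_minor k l) (minor_witness k l))).
have disc := E _ polyfun2_disc disc_witness.
have alx := generically_forall
  (fun j => E _ (polyfun2_align j) (align_witness j)).
have aly : generically (fun M : mat => forall j, align_det
    (affine_coords (rsubmx M)) (affine_coords (lsubmx M)) j != 0).
  apply: generically_forall => j; apply: E (polyfun2_swap (polyfun2_align j)) _.
  by have [x [y xy]] := align_witness j; exists y, x.
have ent : generically (fun M : mat =>
    forall j k, affine_coords (rsubmx M) j k != 0).
  apply: generically_forall => j; apply: generically_forall => k.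
  apply: (E (fun _ y => y j k)) => //.
  by exists 0, (const_mx 1); rewrite mxE oner_neq0.
have := generically_and mins (generically_and disc (generically_and alx
  (generically_and aly ent))).
by apply: generically_sub => M [? [? [? []]]]; split.
Qed.

End Genericity.

(** * Zariski closed sets in products of projective spaces *)

Local Open Scope classical_set_scope.

Section ZariskiClosed.
Variables (K : closedFieldType) (n k : nat).
Implicit Types (f : {mpoly K[n.+1 * k]}) (M : 'M[K]_(n.+1, k)).
Local Notation coords M := (fun l => mxvec M 0 l).

Definition multideg (m : 'X_{1..n.+1 * k}) : 'X_{1..k} :=
  [multinom (\sum_(j < n.+1) m (mxvec_index j i))%N | i < k].

Definition multihomog_part f (d : 'X_{1..k}) : {mpoly K[n.+1 * k]} :=
  \sum_(m <- msupp f | multideg m == d) f@_m *: 'X_[m].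

Lemma multihomog_partP f (d : 'X_{1..k}) : multihomog d (multihomog_part f d).
Proof.
move=> m; rewrite mcoeff_msupp raddf_sum /= => m0 i.
have [<-|ne] := eqVneq (multideg m) d; first by rewrite mnmE.
case/eqP: m0; rewrite big1 // => m' /eqP md; rewrite mcoeffZ mcoeffX.
case: (m' =P m) md ne => [-> <-|_ _ _]; first by rewrite eqxx.
by rewrite mulr0.
Qed.

(** The value of [f] at rescaled coordinates, as a polynomial in the scalars.
    Its coefficients are the values of the multihomogeneous parts of [f]. *)
Definition scaling_poly f M : {mpoly K[k]} :=
  \sum_(m <- msupp f)
     (f@_m * \prod_l mxvec M 0 l ^+ m l) *: 'X_[multideg m].

Definition scale_cols (t : 'I_k -> K) M : 'M[K]_(n.+1, k) :=
  \matrix_(j, i) (t i * M j i).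

Lemma prod_mxvec (G : 'I_(n.+1 * k) -> K) :
  \prod_l G l = \prod_i \prod_j G (mxvec_index j i).
Proof.
rewrite exchange_big pair_big /=; apply: reindex => /=.
have [g gK Kg] := curry_mxvec_bij n.+1 k.
exists g => [[j i]|l] _; first exact: (gK (j, i)).
by rewrite -[RHS]Kg; case: (g l).
Qed.

Lemma scaling_polyE f M t :
  (scaling_poly f M).@[t] = f.@[coords (scale_cols t M)].
Proof.
rewrite /scaling_poly raddf_sum mevalE; apply: eq_bigr => m _.
rewrite /= mevalZ mevalX -mulrA; congr (_ * _); rewrite !prod_mxvec -big_split.
apply: eq_bigr => i _; rewrite mnmE expr_sum /= mulrC -big_split /=.
by apply: eq_bigr => j _; rewrite !mxvecE mxE exprMn.
Qed.

Lemma coef_scaling_poly f M d :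
  (scaling_poly f M)@_d = (multihomog_part f d).@[coords M].
Proof.
rewrite /scaling_poly /multihomog_part !raddf_sum /= big_mkcond /=.
rewrite [RHS]big_mkcond; apply: eq_bigr => m _.
rewrite mcoeffZ mcoeffX mevalZ mevalX.
by case: ifP => _; rewrite ?mulr1 ?mulr0.
Qed.

Lemma col_scale_cols t M i : col i (scale_cols t M) = t i *: col i M.
Proof. by apply/colP => j; rewrite !mxE. Qed.

Lemma vline_scale (V : vectType K) (c : K) (v : V) :
  c != 0 -> <[c *: v]>%VS = <[v]>%VS.
Proof.
move=> c0; apply/eqP; rewrite eqEsubv -!memvE memvZ ?memv_line //=.
by rewrite -{1}[v](scalerK c0) memvZ // memv_line.
Qed.

Lemma hcoords_scale (p : k.-tuple (projspace K n)) t M :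
  (forall i, t i != 0) -> hcoords p M -> hcoords p (scale_cols t M).
Proof. by move=> t0 pM i; rewrite col_scale_cols vline_scale. Qed.

(** The polynomial [scaling_poly f M] vanishes wherever all scalars are
    nonzero, so its product with all the variables vanishes everywhere. *)
Lemma vanishes_multihomog_part f (p : k.-tuple (projspace K n)) :
  vanishes_at f p <-> forall d, vanishes_at (multihomog_part f d) p.
Proof.
split=> [fp d M pM | fp M pM].
  suff S0 : scaling_poly f M = 0 by rewrite -coef_scaling_poly S0 mcoeff0.
  pose X : {mpoly K[k]} := \prod_i 'X_i.
  have X0 : X != 0.
    apply/eqP => /(congr1 (meval (fun=> 1))) /eqP.
    rewrite meval0 rmorph_prod big1 /= ?oner_eq0 // => i _.
    by rewrite mevalXU.
  apply: (mulIf X0); rewrite mul0r; apply: mpoly_eq0_meval => t.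
  rewrite mevalM scaling_polyE.
  have [/forallP t0 | ] := boolP [forall i, t i != 0].
    by rewrite (fp _ (hcoords_scale t0 pM)) mul0r.
  rewrite negb_forall => /existsP[l]; rewrite negbK => /eqP tl0.
  rewrite rmorph_prod (bigD1 l) //= mevalXU tl0 mul0r mulr0 //.
have S0 : scaling_poly f M = 0.
  by apply/mpolyP => d; rewrite coef_scaling_poly mcoeff0; apply: fp.
have := scaling_polyE f M (fun=> 1); rewrite S0 meval0 => ->.
by congr (_.@[_]); apply: funext => l; congr (mxvec _ 0 l);
  apply/matrixP => i j; rewrite mxE mul1r.
Qed.

(** The multihomogeneous parts of the members of [F] define the same set. *)
Lemma zariski_closed_zeros (F : set {mpoly K[n.+1 * k]}) :
  zariski_closed [set p | forall f, F f -> vanishes_at f p].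
Proof.
exists [set g | exists f d, F f /\ g = multihomog_part f d].
  by move=> _ [f [d [_ ->]]]; exists d; apply: multihomog_partP.
apply/seteqP; split=> p /= Fp.
  by move=> _ [f [d [Ff ->]]]; have /vanishes_multihomog_part := Fp f Ff; apply.
by move=> f Ff; apply/vanishes_multihomog_part => d; apply: Fp; exists f, d.
Qed.

Lemma zariski_open_nonzeros f : zariski_open [set p | ~ vanishes_at f p].
Proof.
rewrite /zariski_open; have := @zariski_closed_zeros [set f].
congr zariski_closed; apply/seteqP; split=> p /=.
  by move=> fp; apply; apply: fp.
by move=> /contrapT fp _ ->.
Qed.

Lemma projpointP (v : 'cV[K]_n.+1) : v != 0 ->
  exists q : projspace K n, <[v]>%VS = q.
Proof.
move=> v0; have d1 : \dim <[v]> == 1%N by rewrite dim_vline v0.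
by exists (ProjPoint d1).
Qed.

Lemma projspace_line (q : projspace K n) : exists2 v, v != 0 & <[v]>%VS = q.
Proof.
case: q => V /= dV; exists (vpick V).
  by rewrite vpick0 -dimv_eq0 (eqP dV).
apply/eqP; rewrite eqEdim -memvE memv_pick (eqP dV) dim_vline vpick0.
by rewrite -dimv_eq0 (eqP dV).
Qed.

Lemma hcoords_exists (p : k.-tuple (projspace K n)) : exists M, hcoords p M.
Proof.
have /fin_all_exists2[v v0 vE] : forall i,
    exists2 v, v != 0 & <[v]>%VS = tnth p i.
  by move=> i; apply: projspace_line.
exists (\matrix_(j, i) v i j 0) => i; rewrite -vE; congr (<[_]>%VS).
by apply/colP => j; rewrite !mxE.
Qed.

Lemma hcoords_surj M : (forall i, col i M != 0) -> exists p, hcoords p M.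
Proof.
move=> M0; have /fin_all_exists[q qE] i := projpointP (M0 i).
by exists [tuple q i | i < k] => i; rewrite tnth_mktuple.
Qed.

(** In a factor where [p] and [c] differ, some 2 x 2 minor of the variables
    against coordinates of [c] does not vanish at [p]. *)
Lemma separate_points (p c : k.-tuple (projspace K n)) M : hcoords p M -> p <> c ->
  exists2 f, vanishes_at f c & f.@[coords M] != 0.
Proof.
move=> pM pc; have [s ps] : exists s, tnth p s <> tnth c s.
  apply: contrapT => no_s; apply: pc; apply: eq_from_tnth => s.
  by apply: contrapT => ps; apply: no_s; exists s.
have [w w0 wE] := projspace_line (tnth c s).
have [[a b] /= ab0 | /= ab0] := pickP (fun ab : 'I_n.+1 * 'I_n.+1 =>
    w ab.1 0 * M ab.2 s - w ab.2 0 * M ab.1 s != 0).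
  exists (w a 0 *: 'X_(mxvec_index b s) - w b 0 *: 'X_(mxvec_index a s)).
    move=> N /(_ s); rewrite -wE => cN.
    have : col s N \in <[w]>%VS by rewrite -cN memv_line.
    case/vlineP => e eE; rewrite mevalB !mevalZ !mevalXU !mxvecE.
    have E j : N j s = e * w j 0.
      by have := congr1 (fun v : 'cV_n.+1 => v j 0) eE; rewrite !mxE.
    by rewrite !E; ring.
  by rewrite mevalB !mevalZ !mevalXU !mxvecE.
case: ps; apply: val_inj; rewrite /= -wE -(pM s).
have [a wa] : exists a, w a 0 != 0 
  by have /matrix0Pn[a [z]] := w0; rewrite ord1; exists a.
have E : col s M = (M a s / w a 0) *: w.
  apply/colP => b; rewrite !mxE; have /negbFE/eqP/eqP := ab0 (a, b).
  rewrite /= subr_eq0 => /eqP e; apply: (mulfI wa); rewrite e; by field.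
rewrite E vline_scale //; apply/eqP => e; have := dim_vline (col s M).
by rewrite (pM s) E e scale0r eqxx; case: (tnth p s) => V /= /eqP ->.
Qed.

(** A product of polynomials, each vanishing at one of the points and not at
    [p], separates [p] from all of them. *)
Lemma zariski_closed_finite (I : finType) (c : I -> k.-tuple (projspace K n)) :
  zariski_closed [set p | exists i, p = c i].
Proof.
have := @zariski_closed_zeros [set f | forall i, vanishes_at f (c i)].
congr zariski_closed; apply/seteqP.
split=> p /=; last by move=> [i ->] f; apply.
move=> pF; apply: contrapT => no_i; have [M pM] := hcoords_exists p.
have /fin_all_exists2[f fc fM] i :
    exists2 f, vanishes_at f (c i) & f.@[coords M] != 0.
  by apply: separate_points pM _ => pc; apply: no_i; exists i.
have : (\prod_i f i).@[coords M] == 0.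
  apply/eqP; apply: pF pM => i N cN.
  by rewrite rmorph_prod (bigD1 i) //= (fc i N cN) mul0r.
by rewrite rmorph_prod => /prodf_eq0[i _]; rewrite (negbTE (fM i)).
Qed.

End ZariskiClosed.

(** * The centers variety *)

Section Projective.
Variable K : closedFieldType.

Lemma limg_vline m n (A : 'M[K]_(m, n)) (v : 'cV[K]_n) :
  (linfun (mulmx A) @: <[v]> = <[A *m v]>)%VS.
Proof. by rewrite limg_line lfunE. Qed.

Lemma vline0 (V : vectType K) : <[0 : V]>%VS = 0%VS.
Proof. by apply/eqP; rewrite -subv0 -memvE mem0v. Qed.

Lemma vline_eq (V : vectType K) (u v : V) : u != 0 -> <[u]>%VS = <[v]>%VS ->
  exists2 c, c != 0 & u = c *: v.
Proof.
move=> u0 uv; have : u \in <[v]>%VS by rewrite -uv memv_line.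
case/vlineP => c uE; exists c => //; apply: contraNneq u0 => c0.
by rewrite uE c0 scale0r.
Qed.

Lemma projspace_neq0 n (q : projspace K n) (v : 'cV[K]_n.+1) :
  <[v]>%VS = q -> v != 0.
Proof.
case: q => V /= dV vE; move: dV; rewrite -vE dim_vline; by case: (v != 0).
Qed.

Lemma tuple2_inj (T : Type) (a b a' b' : T) :
  [tuple a; b] = [tuple a'; b'] -> a = a' /\ b = b'.
Proof.
move=> e; split; first by have := congr1 (fun t => tnth t ord0) e.
by have := congr1 (fun t => tnth t (lift ord0 ord0)) e.
Qed.

Variables (X Y : 7.-tuple (projspace K 3)) (XM YM : 'M[K]_(4, 4 + 3)).
Hypotheses (XE : hcoords X XM) (YE : hcoords Y YM).
Hypothesis cr : cross_ratios_differ XM YM.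

Lemma locus_compatible (a b : projspace K 3) (va vb : 'cV[K]_4) :
  <[va]>%VS = a -> <[vb]>%VS = b ->
  centers_locus X Y [tuple a; b] -> compatible XM YM va vb.
Proof.
move=> aE bE [a' [b' [ab _ _ [A [B [[rA cA] [rB cB] [H dH same]]]]]]].
have [ea eb] := tuple2_inj ab.
have ker C (c : projspace K 3) v : <[v]>%VS = c -> center C c -> C *m v = 0.
  move=> cE; rewrite /center -cE limg_vline => e; apply/eqP.
  by rewrite -memv0 -e memv_line.
have /fin_all_exists2[kap kap0 im] : forall i, exists2 k : K, k != 0 &
    A *m col i XM = k *: (H *m B *m col i YM).
  move=> i; have [z] := same i; rewrite /maps_to -XE -YE !limg_vline => Az HBz.
  by apply: vline_eq; [exact: projspace_neq0 Az | rewrite Az HBz].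
have uH : H \in unitmx by rewrite unitmxE dH unitr1.
exists A, (H *m B), kap; split=> //; last 2 first.
- by apply: ker cA; rewrite -ea.
- by rewrite -mulmxA (ker _ _ _ _ cB) ?mulmx0 // -eb.
by split=> //; rewrite (eqmxMfull B) ?row_full_unit.
Qed.

(** The points of [X] are not mapped to zero either: a point in the kernel of
    [A] is the center, which would then be on the lines through that point. *)
Lemma compatible_locus (a b : projspace K 3) (va vb : 'cV[K]_4) :
  <[va]>%VS = a -> <[vb]>%VS = b ->
  compatible XM YM va vb -> centers_locus X Y [tuple a; b].
Proof.
move=> aE bE [A [B [kap [[rA rB] kap0 im Aa Bb]]]].
have va0 := projspace_neq0 aE; have vb0 := projspace_neq0 bE.
have offY := center_off_secants cr rB kap0 im vb0 Bb.
have offX := center_off_secants (cross_ratios_differ_sym cr) rA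
  (fun i => invr_neq0 (kap0 i)) (same_images_sym kap0 im) va0 Aa.
have sec (Z : 7.-tuple (projspace K 3)) (ZM : 'M[K]_(4, 4 + 3)) v
    (q : projspace K 3) : hcoords Z ZM -> <[v]>%VS = q ->
    (forall i j s t, i != j -> v <> s *: col i ZM + t *: col j ZM) ->
    ~ secant_lines Z q.
  move=> ZE qE off [i [j [ij]]]; rewrite -qE -!ZE -memvE.
  move=> /memv_addP[u ui [w wj uw]].
  move: ui wj => /vlineP[s uE] /vlineP[t wE]; apply: (off i j s t).
    by apply: contra_notN ij => /eqP->.
  by rewrite uw uE wE.
exists a, b; split=> //; [exact: sec XE aE offX | exact: sec YE bE offY |].
exists A, B; split.
- by split=> //; rewrite /center -aE limg_vline Aa vline0.
- by split=> //; rewrite /center -bE limg_vline Bb vline0.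
exists 1%:M; first by rewrite det1.
move=> i; have Ax0 : A *m col i XM != 0.
  apply/eqP => Axi; have [c xE] := ker_line rA va0 Aa Axi.
  have xi0 := projspace_neq0 (XE i).
  have c0 : c != 0 by apply: contraNneq xi0 => c0; rewrite xE c0 scale0r.
  apply: (offX i (ordS i) c^-1 0).
    apply/eqP => /(congr1 val).
    by case: i {xE xi0 Axi} => [[|[|[|[|[|[|[|//]]]]]]] ?].
  by rewrite scale0r addr0 xE scalerA mulVf // scale1r.
have [z zE] := projpointP Ax0; exists z.
  by rewrite /maps_to -XE limg_vline.
by rewrite /maps_to -YE limg_vline mul1mx -zE im vline_scale.
Qed.

End Projective.

(** The locus itself is the set of the three pairs; being finite, it is
    closed. *)
Lemma generic_centers_variety (K : closedFieldType)
    (X Y : 7.-tuple (projspace K 3)) (XM YM : 'M[K]_(4, 4 + 3)) :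
  hcoords X XM -> hcoords Y YM -> cross_ratios_differ XM YM ->
  regular (affine_coords XM) (affine_coords YM) ->
  exists p q r : 2.-tuple (projspace K 3),
    [/\ p <> q, p <> r, q <> r & centers_variety X Y = [set p; q; r]].
Proof.
move=> XE YE cr reg.
have [a [b [ab all_ab ab_inj]]] := three_centers cr reg.
have /fin_all_exists[pa paE] r : exists q : projspace K 3, <[a r]>%VS = q.
  by have [a0 _ _] := ab r; exact: projpointP a0.
have /fin_all_exists[pb pbE] r : exists q : projspace K 3, <[b r]>%VS = q.
  by have [_ b0 _] := ab r; exact: projpointP b0.
pose c r := [tuple pa r; pb r].
have c_inj r s : c r = c s -> r = s.
  move=> cE; have [a0 b0 _] := ab s.
  have [ea eb] := tuple2_inj cE.
  have [|k k0 aE] := @vline_eq _ _ (a s) (a r) a0; first by rewrite !paE ea.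
  have [|l l0 bE] := @vline_eq _ _ (b s) (b r) b0; first by rewrite !pbE eb.
  exact: ab_inj aE bE.
have locusE : centers_locus X Y = [set t | exists r, t = c r].
  apply/seteqP; split=> t /=.
    move=> lt; have [qa [qb [tE _ _ _]]] := lt; rewrite tE in lt *.
    have [va va0 vaE] := projspace_line qa.
    have [vb vb0 vbE] := projspace_line qb.
    have [r [s [s' [s0 s'0 ea eb]]]] :=
      all_ab va vb va0 vb0 (locus_compatible XE YE vaE vbE lt).
    have qaE : qa = pa r by apply: val_inj; rewrite /= -vaE -paE ea vline_scale.
    have qbE : qb = pb r by apply: val_inj; rewrite /= -vbE -pbE eb vline_scale.
    by exists r; rewrite qaE qbE.
  move=> [r ->]; have [_ _ comp] := ab r.
  exact: compatible_locus XE YE cr _ _ _ _ (paE r) (pbE r) comp.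
exists (c ord0), (c (ordS ord0)), (c (ordS (ordS ord0))).
split; try by move/c_inj/(congr1 val).
rewrite /centers_variety /zariski_closure locusE smallest_id; last first.
  exact: zariski_closed_finite.
apply/seteqP; split=> t /=.
  move=> [r ->]; move: r.
  by apply: (@forall3 _ ord0); [left; left | left; right | right].
by move=> [[->|->]|->]; eexists.
Qed.

Theorem theorem17 (R : realType) :
  exists U : set ((7 + 7).-tuple (projspace R[i] 3)),
    [/\ zariski_open U, U !=set0 &
     forall X Y : 7.-tuple (projspace R[i] 3),
       U [tuple of X ++ Y] ->
       exists p q r : 2.-tuple (projspace R[i] 3),
         [/\ p <> q, p <> r, q <> r &
          centers_variety X Y = [set p; q; r]]].
Proof.
have [f f0 fP] := generically_regular R[i].
exists [set p | ~ vanishes_at f p]; split.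
- exact: zariski_open_nonzeros.
- have [|M [fM M0]] := @generically_exists R[i] 4 (7 + 7)
      (fun M => f.@[fun l => mxvec M 0 l] != 0 /\ forall i, M ord0 i != 0).
    apply: generically_and; first by exists f.
    (* The columns of [M] have to be nonzero in order to represent points. *)
    apply: generically_forall => i; apply: generically_neq0.
      exact: polyfun_coord.
    by exists (const_mx 1); rewrite mxE oner_neq0.
  have [i|p pM] := @hcoords_surj R[i] 3 (7 + 7) M.
    by apply/eqP => /colP/(_ ord0)/eqP; rewrite !mxE (negbTE (M0 i)).
  by exists p => /= fp; move: fM; rewrite (fp M pM) eqxx.
- move=> X Y /= XYf.
  have [M XYM fM] : exists2 M, hcoords [tuple of X ++ Y] M &
      f.@[fun l => mxvec M 0 l] != 0.
    apply: contrapT => no_M; apply: XYf => M pM; apply/eqP/negPn/negP => fM.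
    by apply: no_M; exists M.
  have [cr reg] := fP M fM.
  apply: generic_centers_variety cr reg => i.
    rewrite -(tnth_lshift X Y) -XYM; congr (<[_]>%VS).
    by apply/colP => j; rewrite !mxE.
  rewrite -(tnth_rshift X Y) -XYM; congr (<[_]>%VS).
  by apply/colP => j; rewrite !mxE.
Qed.
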